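(* Let $1\le p<\infty$, let $\Omega\subset\mathbb{R}^{2d}$ be measurable with $0<|\Omega|<\infty$, and set $S=\mathrm{Id}-\varphi_0\otimes\varphi_0$, where $\varphi_0(t)=2^{d/4}e^{-\pi|t|^2}$ for $t\in\mathbb{R}^d$. Then $$\sup_{f\in L^2(\mathbb{R}^d)\setminus\{0\}}\frac{\|Q_Sf\|_{L^p(\Omega)}}{\|f\|_{L^2}^2}=|\Omega|^{1/p},$$ but the supremum is not attained.
   Context: $L^2(\mathbb{R}^d)$ is a complex Hilbert space with inner product linear in the first entry. For $z=(x,\xi)\in\mathbb{R}^{2d}$, $\pi(z)f(y)=e^{2\pi i\xi\cdot y}f(y-x)$; for a bounded operator $S$ on $L^2(\mathbb{R}^d)$, $\alpha_z(S)=\pi(z)S\pi(z)^*$ and $Q_Sf(z)=\langle\alpha_z(S)f,f\rangle$. The rank-one operator $\varphi_0\otimes\varphi_0$ is $h\mapsto\langle h,\varphi_0\rangle\varphi_0$. *)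

(* Defs.v *)
From HB Require Import structures.
From mathcomp Require Import all_boot all_order all_algebra.
From mathcomp Require Import all_classical all_reals all_analysis.
From mathcomp Require Import complex.

Set Implicit Arguments.
Unset Strict Implicit.
Unset Printing Implicit Defensive.
Import Order.TTheory GRing.Theory Num.Theory.

Local Open Scope classical_set_scope.
Local Open Scope ring_scope.
Local Open Scope complex_scope.

(* R^d with the product (equivalently, Borel) sigma-algebra. *)
Notation Rd R d := (d.-tuple (measurableTypeR R)).

(* d-dimensional Lebesgue measure, by recursion on d: the measure on R^(n+1)
   is the image of leb_1 \x leb_n under (t, y) |-> t :: y. *)
Section lebesgue_step.
Context (R : realType) (n : nat)
  (nu : {sigma_finite_measure set (Rd R n) -> \bar R}).

Definition tcons (u : measurableTypeR R * Rd R n) : Rd R n.+1 :=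
  [tuple of u.1 :: u.2].

Lemma measurable_tcons : measurable_fun [set: measurableTypeR R * Rd R n] tcons.
Proof. by apply: measurable_cons. Qed.

Definition leb_step : set (Rd R n.+1) -> \bar R :=
  pushforward (@lebesgue_measure R \x nu)%E tcons.

Let leb_step0 : leb_step set0 = 0%E.
Proof. by rewrite /leb_step /pushforward preimage_set0 measure0. Qed.

Let leb_step_ge0 A : (0 <= leb_step A)%E.
Proof. exact: integral_ge0. Qed.

Let leb_step_sigma_additive : semi_sigma_additive leb_step.
Proof.
move=> F mF tF mUF; rewrite /leb_step /pushforward preimage_bigcup.
apply: measure_semi_sigma_additive.
- by move=> k; rewrite -[X in measurable X]setTI; exact: measurable_tcons.
- apply/trivIsetP => /= i j _ _ ij; rewrite -preimage_setI.
  by move/trivIsetP : tF => /(_ _ _ _ _ ij) ->//; rewrite preimage_set0.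
- by rewrite -preimage_bigcup -[X in measurable X]setTI; exact: measurable_tcons.
Qed.

HB.instance Definition _ := isMeasure.Build _ _ _ leb_step
  leb_step0 leb_step_ge0 leb_step_sigma_additive.

Let leb_step_sigma_finite : sigma_finite setT leb_step.
Proof.
have /sigma_finiteP[F [TF ndF mF]] := sigma_finiteT (@lebesgue_measure R).
have /sigma_finiteP[G [TG ndG mG]] := sigma_finiteT nu.
exists (fun k => [set y | F k (thead y) /\ G k [tuple of behead y]]).
  apply/seteqP; split => // y _.
  have [i _ Fi] : (\bigcup_k F k) (thead y) by rewrite -TF.
  have [j _ Gj] : (\bigcup_k G k) [tuple of behead y] by rewrite -TG.
  exists (maxn i j) => //; split.
    by move: Fi; exact/subsetPset/ndF/leq_maxl.
  by move: Gj; exact/subsetPset/ndG/leq_maxr.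
move=> k; have [mFk Fk] := mF k; have [mGk Gk] := mG k; split.
  rewrite (_ : mkset _ = (fun y : Rd R n.+1 => tnth y ord0) @^-1` F k `&`
      (fun y : Rd R n.+1 => [tuple of behead y]) @^-1` G k)//.
  apply: measurableI; rewrite -[X in measurable X]setTI.
    exact: measurable_tnth.
  exact: measurable_behead.
rewrite /leb_step /pushforward.
rewrite (_ : _ @^-1` _ = F k `*` G k); last first.
  have tK (u : measurableTypeR R * Rd R n) :
    [tuple of behead (tcons u)] = u.2 by exact: val_inj.
  by apply/seteqP; split => u /=; rewrite tK.
by rewrite product_measure1E// lte_mul_pinfty// ge0_fin_numE.
Qed.

HB.instance Definition _ := Measure_isSigmaFinite.Build _ _ _ leb_step
  leb_step_sigma_finite.

End lebesgue_step.

Fixpoint leb (R : realType) (d : nat) :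
    {sigma_finite_measure set (Rd R d) -> \bar R} :=
  match d with
  | 0 => dirac ([tuple] : Rd R 0)
  | n.+1 => leb_step (leb R n)
  end.

Section L2.
Context (R : realType) (d : nat).
Local Notation E := (Rd R d).
Local Notation C := R[i].
Local Notation mu := (leb R d).
Implicit Types (f g h : E -> C) (S T : (E -> C) -> (E -> C)) (z : E * E).

Definition inner f g : C :=
  (\int[mu]_y complex.Re (f y * conjc (g y))) +i*
  (\int[mu]_y complex.Im (f y * conjc (g y))).

Definition cabs (c : C) : R := complex.Re `|c|.

Definition L2norm f : \bar R := Lnorm mu 2%:E (fun y => (cabs (f y))%:E).

(* L^2(R^d) is represented by its Borel functions (every class has a Borel
   representative); two of them are the same element of L^2(R^d) iff they agree
   almost everywhere. *)
Definition L2 : set (E -> C) := [set f |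
  [/\ measurable_fun setT (fun y => complex.Re (f y) : R),
      measurable_fun setT (fun y => complex.Im (f y) : R) &
      (L2norm f < +oo)%E]].

Definition L2_nonzero : set (E -> C) :=
  [set f | L2 f /\ ~ {ae mu, forall y, f y = 0}].

Definition is_adjoint T T' : Prop :=
  (forall g, L2 g -> L2 (T' g)) /\
  (forall f g, L2 f -> L2 g -> inner (T f) g = inner f (T' g)).

(* The Hilbert space adjoint of T, selected by choice: T' g is determined, for
   g in L^2, up to almost everywhere equality; the default value 0 is returned
   only when T has no adjoint. *)
Definition adjoint T : (E -> C) -> (E -> C) :=
  xget (fun _ _ => 0) [set T' | is_adjoint T T'].

Definition dot (x y : E) : R := \sum_(i < d) (tnth x i : R) * (tnth y i : R).

Definition tsub (x y : E) : E :=
  [tuple (tnth x i : R) - (tnth y i : R) | i < d].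

Definition cis (t : R) : C := cos t +i* sin t.

(* pi(z) for z = (x, xi); the name pi is the real number. *)
Definition tfshift z f : E -> C :=
  fun y => cis (2 * pi * dot z.2 y) * f (tsub y z.1).

Definition alpha z S : (E -> C) -> (E -> C) :=
  fun f => tfshift z (S (adjoint (tfshift z) f)).

Definition Qfun S f z : C := inner (alpha z S f) f.

(* The operator g (x) h : f |-> <f, h> g. *)
Definition rank_one g h : (E -> C) -> (E -> C) :=
  fun f y => inner f h * g y.

Definition phi0 : E -> C :=
  fun t => (2 `^ (d%:R / 4) * expR (- pi * dot t t))%:C.

Definition S0 : (E -> C) -> (E -> C) :=
  fun f y => f y - rank_one phi0 phi0 f y.

(* R^(2d) = R^d * R^d with the Lebesgue sigma-algebra, i.e. the completion of
   the product of the Borel sigma-algebras, and with Lebesgue measure. *)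
Definition phase_space := caratheodory_type ((mu \x mu)%E^*)%mu.

Definition vol : {measure set phase_space -> \bar R} :=
  @completed_measure_extension _ _ _ (mu \x mu)%E.

Definition Lpnorm (p : R) (Omega : set phase_space) (F : E * E -> C) : \bar R :=
  Lnorm vol p%:E ((fun z => (cabs (F z))%:E) \_ Omega).

Definition Qratio (p : R) (Omega : set phase_space) f : \bar R :=
  (Lpnorm p Omega (Qfun S0 f) / L2norm f ^+ 2)%E.

End L2.

(* Main.v *)
(** For f in L^2 put N = ||f||^2 and V(z) = <f, pi(z) phi0>. Unitarity of pi(z)
    gives Q_S f(z) = N - |V(z)|^2, with values in [0, N].

    Taking for f the translates of phi0 by (n, ..., n), for which N = 1, a
    Gaussian integral shows V(z) -> 0 for every z, and dominated convergence
    on Omega yields the lower bound |Omega|^(1/p).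

    The upper bound is strict because V vanishes almost nowhere unless f = 0
    a.e. Up to a positive factor V(x, xi) is the integral over y of
      f(y) exp(-2 i pi xi.y) exp(-pi/2 |y|^2) exp(-pi/2 |y - 2x|^2),
    so it suffices that, for v in L^1(R^d) not a.e. zero, the integral of
    v(y) exp(-c |y - 2x|^2) vanishes for almost no x. Fubini's theorem reduces
    this to d = 1. There, if the zero set is not negligible it has a limit
    point x0, and the Laplace transform of w(t) = v(t) exp(-c (t - 2 x0)^2)
    vanishes along a sequence tending to 0, so all moments of w are zero. As w
    has exponential moments, w is then orthogonal to the algebra generated by
    the functions sin (s (t - a)); half-line indicators are bounded pointwise
    limits of elements of that algebra, whence w = 0 a.e. *)
Require Import Defs.
From mathcomp Require Import all_boot all_order all_algebra.
From mathcomp Require Import all_classical all_reals all_analysis.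
From mathcomp Require Import measurable_realfun.
From mathcomp Require Import complex.
From mathcomp Require Import ring lra.

Set Implicit Arguments.
Unset Strict Implicit.
Unset Printing Implicit Defensive.
Import Order.TTheory GRing.Theory Num.Theory.
Import numFieldNormedType.Exports.

Local Open Scope classical_set_scope.
Local Open Scope ring_scope.

(** Up to a nonvanishing factor V is the Bargmann transform of f, an entire function on C^d, which
    is the deeper reason why its zeros form a null set. Here only real integrals are used: for fixed
    xi the real and imaginary parts of V(., xi) are two real Gaussian integrals. Integrating out all
    variables of v but one leaves a function that depends on the other parameters. The reduction to
    d = 1 is therefore an induction on a property of kernels, quantified over all integrable v,
    which passes to products. Multiplying w by a function g keeps all moments zero as soon as the
    Taylor remainders of g are dominated by an exponential; sines and cosines of any frequency
    qualify. The sine is a globally bounded substitute for t - a: at low frequency it has the sign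
    of t - a on any given bounded set, and where its sign is wrong the polynomial still takes values
    in [0, 1], which is enough for dominated convergence. *)

Notation integrableR mu f := (integrable mu setT (EFin \o f)).

(** * Remainders of exponential-type power series *)

Section series_remainder.
Context {R : realType}.
Implicit Types (c : nat -> R) (v S : R).

Lemma fact_mul_le n k : (n`! * k`! <= (n + k)`!)%N.
Proof.
have kn : (k <= n + k)%N by rewrite leq_addl.
have := bin_fact kn; rewrite addnK => <-.
by rewrite (mulnC n`!) leq_pmull// bin_gt0.
Qed.

Lemma expn_fact_le v n : `|v| ^+ n / n`!%:R <= expR `|v|.
Proof.
have := nondecreasing_cvgn_le _ (is_cvg_series_exp_coeff `|v|) n.+1.
rewrite -[limn _]/(expR `|v|) => h; apply: le_trans (h _).
  rewrite /series/= big_mkord big_ord_recr/= /exp_coeff/= lerDr.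
  by apply: sumr_ge0 => i _; exact: exp_coeff_ge0.
by apply/nondecreasing_seqP => i; rewrite /series/= big_nat_recr//= lerDl exp_coeff_ge0.
Qed.

Lemma series_exp_coeff_le v n : series (exp_coeff `|v|) n <= expR `|v|.
Proof.
apply: nondecreasing_cvgn_le (is_cvg_series_exp_coeff `|v|) n.
by apply/nondecreasing_seqP => i; rewrite /series/= big_nat_recr//= lerDl exp_coeff_ge0.
Qed.

(** As n! k! <= (n + k)!, the tail from index n is at most |v|^n / n! times the exponential series.
    Only the size of the coefficients enters, so exp, cos and sin are covered at once. *)
Lemma series_remainder_le c v S n : (forall k, `|c k| <= (k`!%:R)^-1) ->
  series (fun k => c k * v ^+ k) @ \oo --> S ->
  `|S - \sum_(j < n) c j * v ^+ j| <= `|v| ^+ n / n`!%:R * expR `|v|.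
Proof.
move=> cb cS; pose u := series (fun k => c k * v ^+ k).
have uS : `|u N - \sum_(j < n) c j * v ^+ j| @[N --> \oo] -->
    `|S - \sum_(j < n) c j * v ^+ j|.
  by apply: cvg_norm; apply: cvgB => //; exact: cvg_cst.
rewrite -(cvg_lim _ uS)//; apply: limr_le; first by apply/cvg_ex; eexists; exact: uS.
near=> N; have nN : (n <= N)%N by near: N; exact: nbhs_infty_ge.
rewrite /u /series/= -(big_mkord xpredT (fun j => c j * v ^+ j)).
rewrite (@big_cat_nat _ _ _ n 0 N)//= addrAC subrr add0r.
rewrite -{1}(add0n n) big_addn.
apply: le_trans (ler_norm_sum _ _ _) _.
apply: (@le_trans _ _ (\sum_(0 <= i < N - n)
   `|v| ^+ n / n`!%:R * exp_coeff `|v| i)); last first.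
  rewrite -mulr_sumr; apply: ler_wpM2l; first by rewrite divr_ge0 ?exprn_ge0.
  exact: series_exp_coeff_le.
apply: ler_sum => i _; rewrite normrM normrX /exp_coeff/=.
rewrite mulrACA -exprD (addnC i) mulrC ler_wpM2l ?exprn_ge0//.
rewrite (le_trans (cb _))// -invfM lef_pV2 ?posrE ?mulr_gt0 ?ltr0n ?fact_gt0//.
by rewrite -natrM ler_nat fact_mul_le.
Unshelve. all: by end_near. Qed.

(** The factor 2^n is absorbed by |2v|^n / n! <= exp |2v|, whence the 3. The bound separates into a
    geometric factor in n and a weight independent of n, which can be integrated before n tends to
    infinity. *)
Lemma geom_remainder_le v n :
  `|v| ^+ n / n`!%:R * expR `|v| <= 2^-1 ^+ n * expR (3 * `|v|).
Proof.
have -> : 3 * `|v| = `|2 * v| + `|v| by rewrite normrM ger0_norm//; ring.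
rewrite expRD mulrA ler_wpM2r ?expR_ge0//.
have -> : `|v| ^+ n / n`!%:R = 2^-1 ^+ n * (`|2 * v| ^+ n / n`!%:R).
  by rewrite normrM ger0_norm// exprMn !mulrA -exprMn mulVf// expr1n mul1r.
by rewrite ler_wpM2l ?exprn_ge0// ?invr_ge0// expn_fact_le.
Qed.

Lemma invfact_le_norm (b : R) k : `|b| <= 1 -> `|b * (k`!%:R)^-1| <= (k`!%:R)^-1.
Proof.
move=> b1; rewrite normrM [X in _ * X]ger0_norm ?invr_ge0//.
by rewrite ler_piMl ?invr_ge0.
Qed.

(** The three coefficient sequences share the shape of a number of modulus at most 1 times 1/k!,
    hence the factor 1 here. *)
Definition exp_c k : R := 1 * (k`!%:R)^-1.
Definition cos_c k : R := ((~~ odd k)%:R * (-1) ^+ k./2) * (k`!%:R)^-1.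
Definition sin_c k : R := ((odd k)%:R * (-1) ^+ k.-1./2) * (k`!%:R)^-1.

Lemma exp_c_le k : `|exp_c k| <= (k`!%:R)^-1.
Proof. by apply: invfact_le_norm; rewrite normr1. Qed.
Lemma cos_c_le k : `|cos_c k| <= (k`!%:R)^-1.
Proof.
apply: invfact_le_norm; rewrite normrM normrX normrN1 expr1n mulr1.
by case: (odd k) => /=; rewrite ?normr0 ?normr1.
Qed.
Lemma sin_c_le k : `|sin_c k| <= (k`!%:R)^-1.
Proof.
apply: invfact_le_norm; rewrite normrM normrX normrN1 expr1n mulr1.
by case: (odd k) => /=; rewrite ?normr0 ?normr1.
Qed.

Lemma exp_cE v : series (fun k => exp_c k * v ^+ k) @ \oo --> expR v.
Proof.
have := is_cvg_series_exp_coeff v; rewrite exp_coeffE => h.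
rewrite /expR exp_coeffE; under eq_fun do rewrite /exp_c mul1r.
exact: h.
Qed.

Lemma cos_cE v : series (fun k => cos_c k * v ^+ k) @ \oo --> cos v.
Proof.
have h := @is_cvg_series_cos_coeff R v.
by rewrite trigo.cos.unlock; rewrite cos_coeffE in h *; exact: h.
Qed.

Lemma sin_cE v : series (fun k => sin_c k * v ^+ k) @ \oo --> sin v.
Proof.
have h := @is_cvg_series_sin_coeff R v.
by rewrite trigo.sin.unlock; rewrite sin_coeffE in h *; exact: h.
Qed.

End series_remainder.

(** * Functions with vanishing moments *)

Section integrableR.
Context d (T : measurableType d) (R : realType) (mu : {measure set T -> \bar R}).
Implicit Types f g : T -> R.

Lemma aeS (P Q : T -> Prop) : (forall x, P x -> Q x) ->
  {ae mu, forall x, P x} -> {ae mu, forall x, Q x}.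
Proof. by move=> PQ; apply: filterS. Qed.

Lemma integrableR_mfun f : integrableR mu f -> measurable_fun setT f.
Proof. by move=> /measurable_int/measurable_EFinP. Qed.

Lemma integrableR_le f g : measurable_fun setT f -> integrableR mu g ->
  (forall x, `|f x| <= `|g x|) -> integrableR mu f.
Proof.
move=> mf ig fg; apply: le_integrable ig => //; first exact/measurable_EFinP.
by move=> x _; rewrite /= lee_fin.
Qed.

Lemma Rintegral_norm_le f g : integrableR mu f -> integrableR mu g ->
  (forall x, `|f x| <= g x) -> `|\int[mu]_x f x| <= \int[mu]_x g x.
Proof.
move=> fi gi fg; apply: le_trans (le_normr_Rintegral _ fi) _ => //.
apply: le_Rintegral => //.
exact: (integrable_norm fi).
Qed.

Lemma integrableRD f g : integrableR mu f -> integrableR mu g -> integrableR mu (fun x => f x + g x).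
Proof.
move=> fi gi; have := integrableD measurableT fi gi.
by apply: eq_integrable.
Qed.

Lemma integrableRB f g : integrableR mu f -> integrableR mu g -> integrableR mu (fun x => f x - g x).
Proof.
move=> fi gi; have := integrableB measurableT fi gi.
by apply: eq_integrable.
Qed.

Lemma integrableRZ k f : integrableR mu f -> integrableR mu (fun x => k * f x).
Proof.
move=> fi; have := integrableZl measurableT k fi.
by apply: eq_integrable.
Qed.

End integrableR.

Lemma measurable_cos {R : realType} : measurable_fun [set: R] (@cos R).
Proof. by apply: continuous_measurable_fun; exact: continuous_cos. Qed.

Lemma measurable_sin {R : realType} : measurable_fun [set: R] (@sin R).
Proof. by apply: continuous_measurable_fun; exact: continuous_sin. Qed.

(** * Exponential moments, vanishing moments and multipliers *)

Section rapid.
Context {R : realType}.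
Local Notation mu := (@lebesgue_measure R).
Implicit Types (w g : R -> R).

(** Finiteness of all exponential moments is what allows Taylor remainders to be integrated against
    [w]. *)
Definition rapid w := measurable_fun setT w /\
  forall a, integrableR mu (fun t => w t * expR (a * `|t|)).

Lemma measurable_expR_norm (a : R) : measurable_fun setT (fun t : R => expR (a * `|t|)).
Proof.
by apply: measurableT_comp => //; apply: measurable_funM => //; exact: measurableT_comp.
Qed.

Lemma rapid_integrable w : rapid w -> integrableR mu w.
Proof.
move=> [_ /(_ 0)]; apply: eq_integrable => // x _ /=.
by rewrite mul0r expR0 mulr1.
Qed.

Lemma rapid_bounded w g M : rapid w -> measurable_fun setT g ->
  (forall t, `|g t| <= M) -> rapid (fun t => w t * g t).
Proof.
move=> [mw wa] mg gM; split=> [|a]; first exact: measurable_funM.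
apply: (integrableR_le (T := measurableTypeR R) (g := fun t => M * (w t * expR (a * `|t|)))).
- by apply: measurable_funM; [exact: measurable_funM|exact: measurable_expR_norm].
- exact: integrableRZ.
- move=> t; have M0 : 0 <= M by apply: le_trans (gM t).
  rewrite -mulrA mulrCA normrM [leRHS]normrM (ger0_norm M0).
  by rewrite ler_wpM2r.
Qed.

(** Since |t|^m <= m! exp |t|, the power costs one unit in the exponential rate. *)
Lemma rapidX w m : rapid w -> rapid (fun t => w t * t ^+ m).
Proof.
move=> [mw wa]; split=> [|a].
  by apply: measurable_funM => //; exact: measurable_funX.
apply: (integrableR_le (T := measurableTypeR R) (g := fun t => m`!%:R * (w t * expR ((a + 1) * `|t|)))).
- apply: measurable_funM; last exact: measurable_expR_norm.
  by apply: measurable_funM => //; exact: measurable_funX.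
- exact: integrableRZ.
- move=> t; rewrite mulrDl expRD mul1r !normrM !(ger0_norm (expR_ge0 _)).
  rewrite normrX (@ger0_norm _ m`!%:R)//.
  have : `|t| ^+ m <= m`!%:R * expR `|t|.
    by have := expn_fact_le t m; rewrite ler_pdivrMr ?ltr0n ?fact_gt0// mulrC.
  move=> /(ler_wpM2l (mulr_ge0 (normr_ge0 (w t)) (expR_ge0 (a * `|t|)))) h.
  have -> : `|w t| * `|t| ^+ m * expR (a * `|t|) = `|w t| * expR (a * `|t|) * `|t| ^+ m.
    by ring.
  by apply: le_trans h _; rewrite le_eqVlt; apply/orP; left; apply/eqP; ring.
Qed.

Lemma rapidD w g : rapid w -> rapid g -> rapid (fun t => w t + g t).
Proof.
move=> [mw wa] [mg ga]; split=> [|a]; first exact: measurable_funD.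
have := integrableRD (wa a) (ga a); apply: eq_integrable => // x _ /=.
by rewrite mulrDl.
Qed.

Lemma rapidZ k w : rapid w -> rapid (fun t => k * w t).
Proof.
move=> [mw wa]; split=> [|a]; first exact: measurable_funM.
have := integrableRZ k (wa a); apply: eq_integrable => // x _ /=.
by rewrite mulrA.
Qed.

Definition moments0 w := rapid w /\ forall m, \int[mu]_t (w t * t ^+ m) = 0.

Lemma moments0_ext w g : w =1 g -> moments0 w -> moments0 g.
Proof. by move=> /funext ->. Qed.

Lemma moments0D w g : moments0 w -> moments0 g -> moments0 (fun t => w t + g t).
Proof.
move=> [rw w0] [rg g0]; split=> [|m]; first exact: rapidD.
under eq_Rintegral do rewrite mulrDl.
rewrite RintegralD//; [by rewrite w0 g0 addr0| |].
  exact/rapid_integrable/rapidX.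
exact/rapid_integrable/rapidX.
Qed.

Lemma moments0Z k w : moments0 w -> moments0 (fun t => k * w t).
Proof.
move=> [rw w0]; split=> [|m]; first exact: rapidZ.
under eq_Rintegral do rewrite -mulrA.
by rewrite RintegralZl//; [rewrite w0 mulr0|exact/rapid_integrable/rapidX].
Qed.

Lemma moments0X w j : moments0 w -> moments0 (fun t => w t * t ^+ j).
Proof.
move=> [rw w0]; split=> [|m]; first exact: rapidX.
by under eq_Rintegral do rewrite -mulrA -exprD.
Qed.

Lemma moments0_poly w (c : nat -> R) n : moments0 w ->
  moments0 (fun t => w t * \sum_(j < n) c j * t ^+ j).
Proof.
move=> w0; elim: n => [|n ih].
  apply: moments0_ext (moments0Z 0 w0) => t.
  by rewrite big_ord0 mul0r mulr0.
apply: moments0_ext (moments0D ih (moments0Z (c n) (moments0X n w0))) => t.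
by rewrite big_ord_recr/= mulrDr; congr (_ + _); rewrite mulrCA.
Qed.

Lemma le_geometric0 (x C : R) : (forall n, x <= 2^-1 ^+ n * C) -> x <= 0.
Proof.
move=> h; have gC : (2^-1 : R) ^+ n * C @[n --> \oo] --> 0 * C.
  apply: cvgM; last exact: cvg_cst.
  by apply: cvg_expr; rewrite ger0_norm ?invr_ge0// invf_lt1// ltr1n.
rewrite mul0r in gC; rewrite -(cvg_lim _ gC)//; apply: limr_ge.
  by apply/cvg_ex; eexists; exact: gC.
by apply: nearW => n; exact: h.
Qed.

(** The Taylor polynomial of [g] contributes nothing, because all moments of [w] vanish; the
    remainder contributes at most 2^-n times a fixed exponential moment, for every n. Keeping the
    factor t^m throughout shows that the product has vanishing moments again, so the argument can be
    iterated. *)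
Lemma moments0_entire w g (c : nat -> R) s : moments0 w -> measurable_fun setT g ->
  (forall t, `|g t| <= 1) -> (forall k, `|c k| <= (k`!%:R)^-1) ->
  (forall t, series (fun k => c k * (s * t) ^+ k) @ \oo --> g t) ->
  moments0 (fun t => w t * g t).
Proof.
move=> w0 mg g1 cb cg; have [rw _] := w0.
split=> [|m]; first exact: rapid_bounded g1.
apply/eqP; rewrite -normr_le0.
pose C := \int[mu]_t `|w t * t ^+ m * expR (3 * `|s| * `|t|)|.
have rwm := rapidX m rw.
have iC : integrableR mu (fun t => `|w t * t ^+ m * expR (3 * `|s| * `|t|)|).
  exact: (integrable_norm (rwm.2 (3 * `|s|))).
apply: (@le_geometric0 _ C) => n.
pose P t := \sum_(j < n) (c j * s ^+ j) * t ^+ j.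
have [rP P0] := moments0_poly (fun j => c j * s ^+ j) n w0.
have -> : \int[mu]_t (w t * g t * t ^+ m) =
    \int[mu]_t (w t * g t * t ^+ m - w t * P t * t ^+ m).
  rewrite RintegralB//; first by rewrite P0 subr0.
  - exact/rapid_integrable/rapidX/(rapid_bounded rw mg g1).
  - exact/rapid_integrable/rapidX.
rewrite -RintegralZl//; apply: Rintegral_norm_le.
- apply: integrableRB.
  + exact/rapid_integrable/rapidX/(rapid_bounded rw mg g1).
  + exact/rapid_integrable/rapidX.
- exact: integrableRZ.
- move=> t.
  have -> : w t * g t * t ^+ m - w t * P t * t ^+ m = (w t * t ^+ m) * (g t - P t).
    by ring.
  rewrite normrM [X in _ <= _ * X]normrM mulrCA ler_wpM2l//.
  have -> : P t = \sum_(j < n) c j * (s * t) ^+ j.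
    by apply: eq_bigr => j _; rewrite exprMn mulrA.
  apply: le_trans (series_remainder_le n cb (cg t)) _.
  apply: le_trans (geom_remainder_le _ _) _.
  by rewrite ger0_norm ?expR_ge0// normrM mulrA.
Qed.

(** Quantifying over all [w] makes closure under products immediate, by applying the two factors in
    turn. *)
Definition multiplier g := forall w, moments0 w -> moments0 (fun t => w t * g t).

Lemma multiplier_cst k : multiplier (fun=> k).
Proof. by move=> w /(moments0Z k); apply: moments0_ext => t; rewrite mulrC. Qed.

Lemma multiplierD g h : multiplier g -> multiplier h -> multiplier (fun t => g t + h t).
Proof.
move=> mg mh w w0; apply: moments0_ext (moments0D (mg _ w0) (mh _ w0)) => t.
by rewrite mulrDr.
Qed.

Lemma multiplierM g h : multiplier g -> multiplier h -> multiplier (fun t => g t * h t).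
Proof.
move=> mg mh w w0; apply: moments0_ext (mh _ (mg _ w0)) => t.
by rewrite mulrA.
Qed.

Lemma multiplier_exp g n : multiplier g -> multiplier (fun t => g t ^+ n).
Proof.
move=> mg; elim: n => [|n ih]; first exact: multiplier_cst.
by under eq_fun do rewrite exprS; exact: multiplierM.
Qed.

Lemma multiplier_cos s : multiplier (fun t => cos (s * t)).
Proof.
move=> w w0; apply: (moments0_entire (s := s) (c := cos_c) w0).
- by apply: (measurableT_comp measurable_cos); exact: measurable_funM.
- by move=> t; rewrite ler_norml cos_geN1 cos_le1.
- exact: cos_c_le.
- by move=> t; exact: cos_cE.
Qed.

Lemma multiplier_sin s : multiplier (fun t => sin (s * t)).
Proof.
move=> w w0; apply: (moments0_entire (s := s) (c := sin_c) w0).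
- by apply: (measurableT_comp measurable_sin); exact: measurable_funM.
- by move=> t; rewrite ler_norml sin_geN1 sin_le1.
- exact: sin_c_le.
- by move=> t; exact: sin_cE.
Qed.

Lemma multiplier_sin_affine s a : multiplier (fun t => sin (s * (t - a))).
Proof.
have h : multiplier (fun t => sin (s * t) * cos (s * a) + cos (s * t) * - sin (s * a)).
  by apply: multiplierD; apply: multiplierM;
    [exact: multiplier_sin|exact: multiplier_cst|exact: multiplier_cos|exact: multiplier_cst].
by congr (multiplier _) : h; apply/funext => t; rewrite mulrBr sinB mulrN.
Qed.

End rapid.

(** * Half-line indicators as bounded limits of polynomials in sines *)

Section step.
Context {R : realType}.
Local Notation mu := (@lebesgue_measure R).
Implicit Types (x y : R).

Lemma bernoulli_ge x k : 0 <= x <= 1 -> 1 - k%:R * x <= (1 - x) ^+ k.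
Proof.
move=> /andP[x0 x1]; elim: k => [|k ih]; first by rewrite mul0r subr0.
rewrite exprS; apply: (@le_trans _ _ ((1 - x) * (1 - k%:R * x))).
  have : 0 <= k%:R * x ^+ 2 by rewrite mulr_ge0// sqr_ge0.
  by rewrite -natr1; nra.
by rewrite ler_wpM2l// subr_ge0.
Qed.

Lemma bernoulli_ge1D x k : 0 <= x -> 1 + k%:R * x <= (1 + x) ^+ k.
Proof.
move=> x0; elim: k => [|k ih]; first by rewrite mul0r addr0.
rewrite exprS; apply: (@le_trans _ _ ((1 + x) * (1 + k%:R * x))).
  have : 0 <= k%:R * x ^+ 2 by rewrite mulr_ge0// sqr_ge0.
  by rewrite -natr1; nra.
by rewrite ler_wpM2l// addr_ge0.
Qed.

(** Bernoulli's inequality for 1 + x, together with (1 - x)^k (1 + x)^k = (1 - x^2)^k <= 1. *)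
Lemma bernoulli_le x k : 0 <= x <= 1 -> (1 - x) ^+ k <= (1 + k%:R * x)^-1.
Proof.
move=> /andP[x0 x1].
have pos : 0 < 1 + k%:R * x by rewrite ltr_pwDl// mulr_ge0.
rewrite -[leRHS]mul1r ler_pdivlMr//.
apply: (@le_trans _ _ ((1 - x) ^+ k * (1 + x) ^+ k)).
  by rewrite ler_wpM2l ?bernoulli_ge1D// exprn_ge0// subr_ge0.
rewrite -exprMn exprn_ile1//; first by nra.
have : 0 <= x ^+ 2 by rewrite sqr_ge0.
by nra.
Qed.

(* The polynomials of Brosowski and Deutsch, which converge boundedly to the
   indicator function of the negative numbers. *)
Definition step_poly N y : R := (1 - ((1 + y) / 2) ^+ N) ^+ (2 ^ N).

Lemma step_poly_itv N y : -1 <= y <= 1 -> 0 <= step_poly N y <= 1.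
Proof.
move=> /andP[y1 y2]; rewrite /step_poly.
have h : 0 <= ((1 + y) / 2) ^+ N <= 1.
  by apply/andP; split; [apply: exprn_ge0|apply: exprn_ile1]; lra.
by apply/andP; split; [apply: exprn_ge0|apply: exprn_ile1]; lra.
Qed.

(** The outer exponent 2^N cancels the denominator of ((1 + y) / 2)^N, leaving (1 + y)^N. This is at
    least 1 + N y for y >= 0, and at most 1 / (1 + N |y|) for y <= 0, which gives the companion
    bound. *)
Lemma step_poly_pos N y : 0 <= y <= 1 -> step_poly N y <= (1 + N%:R * y)^-1.
Proof.
move=> /andP[y0 y1]; rewrite /step_poly.
have h : 0 <= ((1 + y) / 2) ^+ N <= 1.
  by apply/andP; split; [apply: exprn_ge0|apply: exprn_ile1]; lra.
apply: le_trans (bernoulli_le _ h) _.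
have pos : 0 < 1 + N%:R * y by rewrite ltr_pwDl// mulr_ge0.
have E : (2 ^ N)%:R * ((1 + y) / 2) ^+ N = (1 + y) ^+ N.
  by rewrite natrX -exprMn mulrCA mulfV ?mulr1.
rewrite E lef_pV2 ?posrE//; last by rewrite ltr_pwDl// exprn_ge0// addr_ge0.
by apply: le_trans (bernoulli_ge1D _ y0) _; rewrite lerDr.
Qed.

Lemma step_poly_neg N y : 0 <= y <= 1 -> 1 - (1 + N%:R * y)^-1 <= step_poly N (- y).
Proof.
move=> /andP[y0 y1]; rewrite /step_poly.
have h : 0 <= ((1 - y) / 2) ^+ N <= 1.
  by apply/andP; split; [apply: exprn_ge0|apply: exprn_ile1]; lra.
apply: le_trans (bernoulli_ge _ h).
have -> : (2 ^ N)%:R * ((1 - y) / 2) ^+ N = (1 - y) ^+ N.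
  by rewrite natrX -exprMn mulrCA mulfV ?mulr1.
by rewrite lerD2l lerN2 bernoulli_le// y0.
Qed.

(** The Taylor remainder of order 2 is at most x^2 exp(x) / 2. On [0, 1/2] one has exp(-x) >= 1 - x
    >= 1/2, so it is at most x^2 <= x / 2. *)
Lemma sin_ge_half x : 0 <= x <= 2^-1 -> x / 2 <= sin x.
Proof.
move=> /andP[x0 x1].
have := series_remainder_le 2 sin_c_le (@sin_cE R x).
have -> : \sum_(j < 2) sin_c j * x ^+ j = x.
  by rewrite !big_ord_recr/= big_ord0 /sin_c/= -[1`!]/1%N; field.
rewrite -[2`!]/2%N (ger0_norm x0) => h.
have e2 : expR x <= 2.
  rewrite -[x]opprK expRN -[leRHS]invrK lef_pV2 ?posrE ?expR_gt0 ?invr_gt0//.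
  by apply: le_trans (expR_ge1Dx _); lra.
have : x ^+ 2 / 2%:R * expR x <= x ^+ 2.
  rewrite -mulrA -[leRHS]mulr1 ler_wpM2l ?sqr_ge0//.
  by rewrite mulrC ler_pdivrMr// mul1r.
move: h; rewrite ler_norml => /andP[h _] h2.
have : x ^+ 2 <= x / 2 by rewrite expr2 ler_wpM2l.
by lra.
Qed.

(** The frequency 1/(n+1) brings each fixed t eventually into the range where the sine is comparable
    to its argument. The sine is then only of order 1/(n+1), and the degree (n+1)^2 makes their
    product tend to infinity. *)
Definition step_fun (a : R) n (t : R) : R :=
  step_poly (n.+1 ^ 2) (sin (n.+1%:R^-1 * (t - a))).

Lemma multiplier_step_fun a n : multiplier (step_fun a n).
Proof.
rewrite /step_fun /step_poly; apply: multiplier_exp.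
under eq_fun do rewrite -mulN1r; apply: multiplierD; first exact: multiplier_cst.
apply: multiplierM; first exact: multiplier_cst.
apply: multiplier_exp; apply: multiplierM; last exact: multiplier_cst.
by apply: multiplierD; [exact: multiplier_cst|exact: multiplier_sin_affine].
Qed.

(** With c = |t - a| the error is at most 2 / (c (n+1)). The point t = a is excluded because the
    values there tend to 1/e. *)
Lemma cvg_step_fun a t : t != a ->
  step_fun a n t @[n --> \oo] --> (\1_(`]-oo, a]) t : R).
Proof.
move=> ta; have c0 : 0 < `|t - a| by rewrite normr_gt0 subr_eq0.
set c := `|t - a| in c0.
have h0 : 2 / c * harmonic n @[n --> \oo] --> (2 / c * 0 : R).
  by apply: cvgM; [exact: cvg_cst|exact: cvg_harmonic].
rewrite mulr0 in h0.
apply/subr_cvg0/norm_cvg0P; apply: (squeeze_cvgr _ (cvg_cst 0) h0).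
near=> n; rewrite normr_ge0/=.
set x := n.+1%:R^-1 * c.
have x12 : 0 <= x <= 2^-1.
  apply/andP; split; first by rewrite /x mulr_ge0// ltW.
  rewrite /x mulrC ler_pdivrMr// mulrC -ler_pdivrMr ?invr_gt0// invrK mulrC.
  have : 2 * c <= n%:R by near: n; exact: nbhs_infty_ger.
  by move=> /le_trans; apply; rewrite ler_nat.
have sx := sin_ge_half x12.
have Nx : (1 + (n.+1 ^ 2)%:R * sin x)^-1 <= 2 / c * harmonic n.
  have c2 : 0 < n.+1%:R * c / 2 by rewrite divr_gt0// mulr_gt0.
  have hh : n.+1%:R * c / 2 <= 1 + (n.+1 ^ 2)%:R * sin x.
    apply: (@le_trans _ _ ((n.+1 ^ 2)%:R * (x / 2))).
      rewrite /x natrX le_eqVlt; apply/orP; left; apply/eqP.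
      have : n.+1%:R != 0 :> R by rewrite pnatr_eq0.
      by move: n.+1%:R => k k0; field.
    apply: (@le_trans _ _ ((n.+1 ^ 2)%:R * sin x)); first by rewrite ler_wpM2l.
    by rewrite lerDr.
  have -> : 2 / c * harmonic n = (n.+1%:R * c / 2)^-1.
    rewrite /harmonic/=; have : n.+1%:R != 0 :> R by rewrite pnatr_eq0.
    by move: n.+1%:R => k k0; field; rewrite k0 gt_eqF.
  by rewrite lef_pV2 ?posrE//; exact: lt_le_trans hh.
have sx01 : 0 <= sin x <= 1.
  by rewrite sin_le1 andbT; apply: le_trans sx; case/andP: x12 => x0 _; rewrite divr_ge0.
apply: le_trans Nx.
rewrite /step_fun; move: ta; rewrite neq_lt => /orP[ta|ta].
- have -> : \1_(`]-oo, a]) t = 1 :> R by rewrite indicE mem_set//= in_itv/= ltW.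
  have -> : n.+1%:R^-1 * (t - a) = - x by rewrite /x /c ltr0_norm ?subr_lt0//; ring.
  rewrite sinN; have := step_poly_neg (n.+1 ^ 2) sx01.
  have := @step_poly_itv (n.+1 ^ 2) (- sin x).
  have : -1 <= - sin x <= 1 by case/andP: sx01 => s0 s1; apply/andP; split; lra.
  by move=> hs /(_ hs)/andP[_ h1] h2; rewrite distrC ger0_norm; lra.
- have -> : \1_(`]-oo, a]) t = 0 :> R.
    by rewrite indicE memNset//= in_itv/=; apply/negP; rewrite -ltNge.
  have -> : n.+1%:R^-1 * (t - a) = x by rewrite /x /c gtr0_norm ?subr_gt0.
  have := step_poly_pos (n.+1 ^ 2) sx01.
  have := @step_poly_itv (n.+1 ^ 2) (sin x).
  have : -1 <= sin x <= 1 by case/andP: sx01 => s0 s1; apply/andP; split; lra.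
  by move=> hs /(_ hs)/andP[h1 _] h2; rewrite subr0 ger0_norm.
Unshelve. all: by end_near. Qed.

(** Dominated convergence with majorant |w|: each approximating integral is the moment of order 0 of
    [w] times a multiplier. The exceptional set {a} is negligible. *)
Lemma moments0_integral_itv (w : R -> R) a : moments0 w ->
  \int[mu]_(t in `]-oo, a]) w t = 0.
Proof.
move=> w0; have [rw _] := w0; have iw := rapid_integrable rw.
have [mw _] := rw.
rewrite Rintegral_mkcond.
have mf n : measurable_fun setT (EFin \o (fun t => w t * step_fun a n t)).
  by apply/measurable_EFinP; have [[]] := multiplier_step_fun a n w0.
have ml : measurable_fun setT (EFin \o (w \_ `]-oo, a])).
  apply/measurable_EFinP/(measurable_restrictT _ _).1 => //.
  exact: measurable_funS mw.
have [] := @dominated_convergence _ _ _ mu setT measurableT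
  (fun n t => (w t * step_fun a n t)%:E) (EFin \o (w \_ `]-oo, a]))
  (EFin \o (fun t => `|w t|)) mf ml.
- exists [set a]; split=> //; first exact: lebesgue_measure_set1.
  move=> t /= /not_implyP[_ tl]; apply: contrapT => /eqP ta; apply: tl.
  apply: cvg_EFin; first exact: nearW.
  rewrite patchE -[X in _ --> X]/(if t \in `]-oo, a]%classic then w t else 0).
  have -> : (if t \in `]-oo, a]%classic then w t else 0) = w t * \1_(`]-oo, a]) t.
    by rewrite indicE; case: ifPn => _; rewrite ?mulr1 ?mulr0.
  by apply: cvgM; [exact: cvg_cst|exact: cvg_step_fun].
- exact: integrable_norm iw.
- apply: aeW => t n _ /=; rewrite lee_fin normrM ler_piMr//.
  have := @step_poly_itv (n.+1 ^ 2) (sin (n.+1%:R^-1 * (t - a))).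
  by rewrite sin_geN1 sin_le1 => /(_ isT)/andP[p0 p1]; rewrite ger0_norm.
move=> _ _ /=.
have -> : (fun n => \int[mu]_t (w t * step_fun a n t)%:E)%E = cst 0%E.
  apply/funext => n; have [rwn] := multiplier_step_fun a n w0.
  move=> /(_ 0%N); under eq_Rintegral do rewrite expr0 mulr1.
  by rewrite /Rintegral => h; rewrite -[LHS]fineK ?h//; exact/integrable_fin_num/rapid_integrable.
move=> /cvg_lim; rewrite lim_cst// => /(_ (@ereal_hausdorff R)) h.
by rewrite /Rintegral -h.
Qed.

(** The primitive of [w] from -oo vanishes identically, and its derivative is [w] almost
    everywhere. *)
Lemma moments0_ae0 (w : R -> R) : moments0 w -> {ae mu, forall t, w t = 0}.
Proof.
move=> w0; have [rw _] := w0; have iw := rapid_integrable rw.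
have lw : locally_integrable [set: R] w.
  by have := integrable_locally measurableT iw; rewrite patch_setT.
have iwy y : mu.-integrable `]-oo, y] (EFin \o w) by exact: integrableS iw.
have := FTC1Ny iwy lw; apply: aeS => t [_].
rewrite (_ : (fun x => _) = cst 0) ?derive1_cst//.
by apply/funext => a; exact: moments0_integral_itv.
Qed.

End step.

(** * The Laplace transform and the Gaussian kernel in dimension one *)

Section laplace.
Context {R : realType}.
Local Notation mu := (@lebesgue_measure R).
Implicit Types (w v : R -> R).

Lemma rapid_poly w (p : nat -> R) n : rapid w ->
  rapid (fun t => w t * \sum_(j < n) p j * t ^+ j).
Proof.
move=> rw; elim: n => [|n ih].
  have := rapidZ 0 rw; congr rapid; apply/funext => t.
  by rewrite big_ord0 mul0r mulr0.
have := rapidD ih (rapidZ (p n) (rapidX n rw)); congr rapid; apply/funext => t.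
by rewrite big_ord_recr/= mulrDr; congr (_ + _); rewrite mulrCA.
Qed.

Lemma Rintegral_poly w (p : nat -> R) n : rapid w ->
  \int[mu]_t (w t * \sum_(j < n) p j * t ^+ j) =
  \sum_(j < n) p j * \int[mu]_t (w t * t ^+ j).
Proof.
move=> rw; elim: n => [|n ih].
  rewrite big_ord0; under eq_Rintegral do rewrite big_ord0 mulr0.
  by rewrite Rintegral_cst// mul0r.
under eq_Rintegral do rewrite big_ord_recr/= mulrDr (mulrCA (w _)).
rewrite RintegralD//; last 2 first.
- exact/rapid_integrable/rapid_poly.
- exact/rapid_integrable/rapidZ/rapidX.
by rewrite ih big_ord_recr/= RintegralZl//; exact/rapid_integrable/rapidX.
Qed.

Lemma rapid_laplace w s : rapid w -> rapid (fun t => w t * expR (s * t)).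
Proof.
move=> [mw wa]; split=> [|a].
  by apply: measurable_funM => //; apply: measurableT_comp => //; exact: measurable_funM.
apply: (integrableR_le (T := measurableTypeR R)
  (g := fun t => w t * expR ((`|s| + a) * `|t|))) => //.
- apply: measurable_funM; last exact: measurable_expR_norm.
  by apply: measurable_funM => //; apply: measurableT_comp => //; exact: measurable_funM.
- move=> t; rewrite !normrM -mulrA ler_wpM2l// !(ger0_norm (expR_ge0 _)).
  by rewrite -expRD ler_expR mulrDl lerD2r -normrM ler_norm.
Qed.

(* Taylor expansion at 0 of the Laplace transform: as it vanishes along a
   sequence of points tending to 0, so do all its coefficients, the moments. *)
Lemma laplace_moments0 w : rapid w ->
  (forall e : R, 0 < e -> exists s : R, 0 < `|s| < e /\ \int[mu]_t (w t * expR (s * t)) = 0) ->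
  moments0 w.
Proof.
move=> rw w0; split=> // m; elim/ltn_ind: m => n ih.
set M := \int[mu]_t _; apply/eqP; apply: contrapT => /negP M0.
have Mgt0 : 0 < `|M| by rewrite normr_gt0.
pose C := \int[mu]_t `|w t * t ^+ n.+1 * expR (1 * `|t|)|.
have iC : integrableR mu (fun t => `|w t * t ^+ n.+1 * expR (1 * `|t|)|).
  exact: (integrable_norm ((rapidX n.+1 rw).2 1)).
have C0 : 0 <= C.
  by apply: fine_ge0; apply: integral_ge0 => t _; rewrite lee_fin.
have f0 : 0 < n`!%:R :> R by rewrite ltr0n fact_gt0.
(* For |s| <= 1 the remainder is at most |s|^(n+1) C, while the main term is |s|^n |M| / n!; the
   second bound on |s| makes the main term larger. C + 1 replaces C to keep the denominator
   positive. *)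
have e0 : 0 < Num.min 1 (`|M| / (n`!%:R * (C + 1))).
  by rewrite lt_min ltr01/= divr_gt0// mulr_gt0// ltr_wpDl.
have [s [/andP[s0]]] := w0 _ e0; rewrite lt_min => /andP[s1 sM] ws.
pose P t := \sum_(j < n.+1) (exp_c j * s ^+ j) * t ^+ j.
have rP : rapid (fun t => w t * P t) := (rapid_poly (fun j => exp_c j * s ^+ j) n.+1 rw).
have rE : rapid (fun t => w t * expR (s * t)) by exact: rapid_laplace.
(* By the induction hypothesis only the top term of the Taylor polynomial survives. *)
have PE : \int[mu]_t (w t * P t) = s ^+ n / n`!%:R * M.
  rewrite (Rintegral_poly (fun j => exp_c j * s ^+ j) n.+1 rw) big_ord_recr/= big1 ?add0r.
    by rewrite /exp_c mul1r -/M; congr (_ * _); rewrite mulrC.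
  by move=> j _; rewrite ih// mulr0.
have rem : `|s ^+ n / n`!%:R * M| <= `|s| ^+ n.+1 * C.
  have -> : s ^+ n / n`!%:R * M = - \int[mu]_t (w t * expR (s * t) - w t * P t).
    rewrite RintegralB//; [|exact: rapid_integrable|exact: rapid_integrable].
    by rewrite ws sub0r opprK PE.
  rewrite normrN /C -RintegralZl//; apply: Rintegral_norm_le.
  - by apply: integrableRB; exact: rapid_integrable.
  - exact: integrableRZ.
  - move=> t; rewrite -mulrBr normrM mul1r 2!normrM normrX (ger0_norm (expR_ge0 _)).
    have -> : P t = \sum_(j < n.+1) exp_c j * (s * t) ^+ j.
      by apply: eq_bigr => j _; rewrite exprMn mulrA.
    have -> : `|s| ^+ n.+1 * (`|w t| * `|t| ^+ n.+1 * expR `|t|) =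
       `|w t| * (`|s| ^+ n.+1 * `|t| ^+ n.+1 * expR `|t|) by ring.
    rewrite ler_wpM2l//; apply: le_trans (series_remainder_le n.+1 exp_c_le (@exp_cE R (s * t))) _.
    rewrite normrM exprMn ler_pM ?expR_ge0//.
    + rewrite ler_pdivrMr ?ltr0n ?fact_gt0// ler_peMr ?mulr_ge0 ?exprn_ge0//.
      by rewrite ler1n fact_gt0.
    + by rewrite ler_expR ler_piMl// ltW.
move: rem; rewrite !normrM normrX exprSr -!mulrA ler_pM2l ?exprn_gt0//.
rewrite (ger0_norm (_ : 0 <= n`!%:R^-1)) ?invr_ge0// ler_pdivrMl//.
apply/negP; rewrite -ltNge.
move: sM; rewrite ltr_pdivlMr; last by rewrite mulr_gt0// ltr_wpDl.
apply: le_lt_trans; rewrite mulrCA ler_wpM2l// ler_wpM2l//.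
by rewrite lerDl.
Qed.

Definition gker (c x t : R) : R := expR (- (c * (t - 2 * x) ^+ 2)).

Lemma measurable_gker c x : measurable_fun setT (gker c x).
Proof.
apply: measurableT_comp => //; apply: measurableT_comp => //.
apply: measurable_funM => //; apply: measurable_funX.
exact: measurable_funB.
Qed.

(** Moving the centre multiplies the Gaussian by an exponential in t, up to a positive constant: a
    zero of the Gaussian integral at x + h is a zero of a Laplace transform at 4 c h. *)
Lemma gker_shift c x h t :
  gker c (x + h) t = gker c x t * expR (4 * c * h * t) * expR (- (8 * c * h * x + 4 * c * h ^+ 2)).
Proof. by rewrite /gker -!expRD; congr expR; ring. Qed.

(** Completing the square gives |a| q <= c q^2 + a^2 / (4 c) with q = |t - 2x|, so the Gaussian
    absorbs the exponential weight up to the constant B. *)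
Lemma rapid_gker c x v : 0 < c -> integrableR mu v -> rapid (fun t => v t * gker c x t).
Proof.
move=> c0 iv; have mv := integrableR_mfun iv.
have mvg : measurable_fun setT (fun t => v t * gker c x t).
  by apply: measurable_funM => //; exact: measurable_gker.
split=> // a; pose B := expR (a ^+ 2 / (4 * c) + 2 * `|a| * `|x|).
apply: (integrableR_le (T := measurableTypeR R) (g := fun t => B * v t)).
- by apply: measurable_funM => //; exact: measurable_expR_norm.
- exact: integrableRZ.
- move=> t; rewrite -mulrA (mulrC (v t)) (normrM _ (v t)) (normrM B) ler_wpM2r//.
  rewrite /gker -expRD !(ger0_norm (expR_ge0 _)) ler_expR.
  have h1 : a * `|t| <= `|a| * `|t - 2 * x| + 2 * `|a| * `|x|.
    apply: (@le_trans _ _ (`|a| * `|t|)); first by rewrite ler_wpM2r ?ler_norm.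
    have -> : 2 * `|a| * `|x| = `|a| * (2 * `|x|) by ring.
    rewrite -mulrDr ler_wpM2l//.
    have -> : 2 * `|x| = `|2 * x| by rewrite normrM ger0_norm.
    by rewrite -[in leLHS](subrK (2 * x) t) ler_normD.
  have h2 : `|a| * `|t - 2 * x| <= c * `|t - 2 * x| ^+ 2 + a ^+ 2 / (4 * c).
    rewrite -(real_normK (num_real a)).
    have : 0 <= (2 * c * `|t - 2 * x| - `|a|) ^+ 2 / (4 * c).
      by rewrite divr_ge0 ?sqr_ge0// mulr_ge0// ltW.
    move: `|a| `|t - 2 * x| => p q.
    have -> : (2 * c * q - p) ^+ 2 / (4 * c) = c * q ^+ 2 + p ^+ 2 / (4 * c) - p * q.
      by field; rewrite gt_eqF.
    by rewrite subr_ge0.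
  move: h2; rewrite real_normK ?num_real//; lra.
Qed.

Lemma gker_integral_neq0 c v : 0 < c -> integrableR mu v ->
  ~ {ae mu, forall t, v t = 0} ->
  {ae mu, forall x, \int[mu]_t (v t * gker c x t) != 0}.
Proof.
move=> c0 iv v0; apply: contrapT => hZ.
pose Z := [set x | \int[mu]_t (v t * gker c x t) = 0].
(* If Z met every bounded interval in a finite set, it would be countable, hence negligible. *)
have [M ZM] : exists M : nat, infinite_set (Z `&` `[- M%:R, M%:R]).
  apply: contrapT => /forallNP fZ; apply: hZ.
  have cZ : countable Z.
    have -> : Z = \bigcup_M (Z `&` `[- M%:R, M%:R]).
      rewrite -setI_bigcupr; apply/seteqP; split=> [x Zx|x []//]; split=> //.
      exists (Num.truncn `|x|).+1 => //=.
      by rewrite in_itv/= -ler_norml ltW// truncnS_gt.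
    apply: bigcup_countable => // i _; apply: finite_set_countable.
    by apply: contrapT; exact: fZ.
  exists Z; split.
  - exact: countable_measurable.
  - exact: countable_lebesgue_measure0.
  - by move=> x /= /negP; rewrite negbK => /eqP.
have [] := infinite_bounded_limit_point_nonempty ZM.
  exists M%:R; split=> // r Mr x [_ /=]; rewrite in_itv/= -ler_norml => /le_trans.
  by apply; rewrite ltW.
move=> x0 lx0; apply: v0.
have rw := rapid_gker x0 c0 iv.
have : {ae mu, forall t, v t * gker c x0 t = 0}.
  apply/moments0_ae0/laplace_moments0 => // e e0.
  (* The Laplace parameter belonging to y is 4 c (y - x0), which explains the radius. *)
  have [|y [yx0 [Zy _] yU]] := lx0 (ball x0 (e / (4 * c))).
    by apply: nbhsx_ballx; rewrite divr_gt0// mulr_gt0.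
  exists (4 * c * (y - x0)); split.
    rewrite normr_gt0 mulf_neq0 ?subr_eq0//= ?gt_eqF ?mulr_gt0//.
    rewrite normrM gtr0_norm ?mulr_gt0//.
    move: yU; rewrite /ball/= distrC ltr_pdivlMr ?mulr_gt0//.
    by rewrite mulrC.
  have := Zy; rewrite /Z/= -{1}(subrK x0 y) addrC.
  under eq_Rintegral do rewrite gker_shift !mulrA.
  rewrite RintegralZr//; last first.
    exact/rapid_integrable/rapid_laplace.
  by move/eqP; rewrite mulf_eq0 orbC gt_eqF ?expR_gt0//= => /eqP.
by apply: aeS => t /eqP; rewrite mulf_eq0 orbC gt_eqF ?expR_gt0//= => /eqP.
Qed.

End laplace.

(** * Fubini arguments *)

Section ae_general.
Context d (T : measurableType d) (R : realType) (mu : {measure set T -> \bar R}).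

Lemma ae_measure0P (P : T -> Prop) : measurable [set x | P x] ->
  {ae mu, forall x, P x} <-> mu [set x | ~ P x] = 0%E.
Proof.
by move=> mP; apply: negligibleP; exact: measurableC.
Qed.

Lemma ae_and (P Q : T -> Prop) : {ae mu, forall x, P x} -> {ae mu, forall x, Q x} ->
  {ae mu, forall x, P x /\ Q x}.
Proof. by move=> hP hQ; apply: filterS2 hP hQ. Qed.

Lemma ge0_integral_eq0P (f : T -> \bar R) : measurable_fun setT f ->
  (forall x, 0 <= f x)%E ->
  (\int[mu]_x f x = 0)%E <-> {ae mu, forall x, f x = 0%E}.
Proof.
move=> mf f0; have := ae_eq_integral_abs mu measurableT mf.
under eq_integral do rewrite gee0_abs//.
move=> h; split=> [/h|f00]; first by apply: aeS => x; exact.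
by apply/h; apply: aeS f00.
Qed.

Lemma Rintegral_ae_eq (f g : T -> R) : measurable_fun setT f -> measurable_fun setT g ->
  {ae mu, forall x, f x = g x} -> \int[mu]_x f x = \int[mu]_x g x.
Proof.
move=> mf mg fg; congr fine; apply: ae_eq_integral => //; try exact/measurable_EFinP.
by apply: aeS fg => x -> .
Qed.

Lemma measurable_eq0 (f : T -> R) : measurable_fun setT f -> measurable [set x | f x = 0].
Proof.
move=> mf; rewrite (_ : [set x | _] = f @^-1` [set 0])//.
by rewrite -[X in measurable X]setTI; exact: mf.
Qed.

Lemma measurable_neq0 (f : T -> R) : measurable_fun setT f -> measurable [set x | f x != 0].
Proof.
move=> /measurable_eq0/measurableC; congr measurable.
by apply/seteqP; split => x /= /eqP.
Qed.

Lemma EFin_Rintegral (f : T -> R) : integrableR mu f ->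
  (\int[mu]_x f x)%:E = (\int[mu]_x (f x)%:E)%E.
Proof. by move=> fi; rewrite fineK//; exact: integrable_fin_num. Qed.

End ae_general.

Section fubini.
Context d1 d2 (T1 : measurableType d1) (T2 : measurableType d2) (R : realType).
Context (m1 : {sigma_finite_measure set T1 -> \bar R})
        (m2 : {sigma_finite_measure set T2 -> \bar R}).

Lemma ae_prod (P : T1 * T2 -> Prop) : measurable [set z | P z] ->
  {ae (m1 \x m2)%E, forall z, P z} <-> {ae m1, forall x, {ae m2, forall y, P (x, y)}}.
Proof.
move=> mP; have mN : measurable [set z | ~ P z] by exact: measurableC.
have mx x : measurable [set y | P (x, y)].
  have := measurable_xsection x mP; congr measurable.
  by apply/seteqP; split=> y; rewrite /xsection/= inE.
rewrite ae_measure0P// /product_measure1 ge0_integral_eq0P//; last first.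
  exact: measurable_fun_xsection.
have E x : (m2 \o xsection [set z | ~ P z]) x = 0%E <-> {ae m2, forall y, P (x, y)}.
  rewrite ae_measure0P//=; split; move=> <-; congr (m2 _);
    by apply/seteqP; split=> y; rewrite /xsection/= inE.
by split; apply: aeS => x /E.
Qed.

(** [\x] is defined through sections in the first variable; uniqueness of the product measure
    identifies it with the measure built from the other sections. *)
Lemma ae_prod_swap (P : T1 * T2 -> Prop) : measurable [set z | P z] ->
  {ae (m1 \x m2)%E, forall z, P z} <-> {ae m2, forall y, {ae m1, forall x, P (x, y)}}.
Proof.
move=> mP; have mN : measurable [set z | ~ P z] by exact: measurableC.
have my y : measurable [set x | P (x, y)].
  have := measurable_ysection y mP; congr measurable.
  by apply/seteqP; split=> x; rewrite /ysection/= inE.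
have -> : {ae (m1 \x m2)%E, forall z, P z} <-> (m1 \x^ m2)%E [set z | ~ P z] = 0%E.
  have E : (m1 \x m2)%E [set z | ~ P z] = (m1 \x^ m2)%E [set z | ~ P z].
    by apply: product_measure_unique => // A B mA mB; exact: product_measure2E.
  by rewrite -E; exact: ae_measure0P.
rewrite /product_measure2 ge0_integral_eq0P//; last exact: measurable_fun_ysection.
have E y : (m1 \o ysection [set z | ~ P z]) y = 0%E <-> {ae m1, forall x, P (x, y)}.
  rewrite ae_measure0P//=; split; move=> <-; congr (m1 _);
    by apply/seteqP; split=> x; rewrite /ysection/= inE.
by split; apply: aeS => y /E.
Qed.

(** Tonelli applied to the positive and negative parts covers also the x at which the inner integral
    diverges, where [fine] supplies a value. *)
Lemma measurable_Rintegral_param (f : T1 * T2 -> R) : measurable_fun setT f ->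
  measurable_fun setT (fun x => \int[m2]_y f (x, y)).
Proof.
move=> mf; apply: measurableT_comp => //.
have -> : (fun x => \int[m2]_y (f (x, y))%:E)%E =
  ((fun x => \int[m2]_y (EFin \o f)^\+%E (x, y)) \-
   (fun x => \int[m2]_y (EFin \o f)^\-%E (x, y)))%E.
  apply/funext => x /=; rewrite [LHS]integralE.
  by congr (_ - _)%E; apply: eq_integral => y _; rewrite ?funeposE ?funenegE.
have mEf : measurable_fun setT (EFin \o f) by exact/measurable_EFinP.
apply: emeasurable_funB.
  by apply: (measurable_fun_fubini_tonelli_F ((EFin \o f)^\+)%E) => //; exact: measurable_funepos.
by apply: (measurable_fun_fubini_tonelli_F ((EFin \o f)^\-)%E) => //; exact: measurable_funeneg.
Qed.

Lemma ae_integrableR1 (f : T1 * T2 -> R) : integrableR (m1 \x m2)%E f ->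
  {ae m1, forall x, integrableR m2 (fun y => f (x, y))}.
Proof. by move=> /ae_integrable1. Qed.

Lemma integrableR_Rintegral1 (f : T1 * T2 -> R) : integrableR (m1 \x m2)%E f ->
  integrableR m1 (fun x => \int[m2]_y f (x, y)).
Proof.
move=> fi; apply: le_integrable (integrable_fubini_F fi) => //.
  apply/measurable_EFinP; apply: measurable_Rintegral_param; exact: (integrableR_mfun fi).
(* An infinite inner integral is turned into 0 by [fine], so the bound survives in that case. *)
move=> x _ /=; rewrite /Rintegral /fubini_F; case: (integral _ _ _) => [r| |]/=.
- exact: lexx.
- exact: leey.
- exact: leey.
Qed.

Lemma Rintegral_prod (f : T1 * T2 -> R) : integrableR (m1 \x m2)%E f ->
  \int[(m1 \x m2)%E]_z f z = \int[m1]_x \int[m2]_y f (x, y).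
Proof.
move=> fi; rewrite {1}/Rintegral -(integral12_prod_meas1 fi); congr fine.
apply: ae_eq_integral => //.
- exact: (measurable_fubini_F fi).
- apply/measurable_EFinP; apply: measurable_Rintegral_param; exact: (integrableR_mfun fi).
- apply: aeS (ae_integrableR1 fi) => x fx _.
  by rewrite /fubini_F /= EFin_Rintegral.
Qed.

End fubini.

(** * Kernels whose integrals vanish almost nowhere *)

Section nondegenerate_kernel.

(** The form of the nonvanishing statement that is stable under products. The bound by 1 makes v K
    integrable whenever v is. *)
Definition nondegenerate_kernel d (T : measurableType d) (R : realType)
    (m : {measure set T -> \bar R}) (K : T -> T -> R) :=
  [/\ measurable_fun setT (fun z : T * T => K z.1 z.2),
      forall x t, `|K x t| <= 1 &
      forall v, integrableR m v -> ~ {ae m, forall t, v t = 0} ->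
        {ae m, forall x, \int[m]_t (v t * K x t) != 0}].

Context d1 d2 (T1 : measurableType d1) (T2 : measurableType d2) (R : realType).
Context (m1 : {sigma_finite_measure set T1 -> \bar R})
        (m2 : {sigma_finite_measure set T2 -> \bar R}).

(** Integrating v(t, .) against K2 gives H(t, x'). For each t with integrable section outside a null
    set and v(t, .) not a.e. zero, H(t, x') is nonzero for almost every x'. Exchanging the
    quantifiers, for almost every x' the function H(., x') is not a.e. zero, and K1 applies to
    it. *)
Lemma nondegenerate_kernel_prod (K1 : T1 -> T1 -> R) (K2 : T2 -> T2 -> R) :
  nondegenerate_kernel m1 K1 -> nondegenerate_kernel m2 K2 ->
  nondegenerate_kernel (m1 \x m2)%E (fun x t : T1 * T2 => K1 x.1 t.1 * K2 x.2 t.2).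
Proof.
move=> [mK1 K1b K1n] [mK2 K2b K2n].
have mK : measurable_fun setT (fun z : (T1 * T2) * (T1 * T2) =>
    K1 z.1.1 z.2.1 * K2 z.1.2 z.2.2).
  apply: measurable_funM.
  - apply: (measurableT_comp mK1 (_ : measurable_fun setT
      (fun z : (T1 * T2) * (T1 * T2) => (z.1.1, z.2.1)))).
    by apply: measurable_fun_pair; apply: measurableT_comp.
  - apply: (measurableT_comp mK2 (_ : measurable_fun setT
      (fun z : (T1 * T2) * (T1 * T2) => (z.1.2, z.2.2)))).
    by apply: measurable_fun_pair; apply: measurableT_comp.
split=> //.
  by move=> x t; rewrite normrM mulr_ile1.
move=> v iv v0; have mv := integrableR_mfun iv.
pose H (z : T1 * T2) := \int[m2]_y (v (z.1, y) * K2 z.2 y).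
have mH : measurable_fun setT H.
  apply: (@measurable_Rintegral_param _ _ (T1 * T2)%type T2 R m2
    (fun u => v (u.1.1, u.2) * K2 u.1.2 u.2)).
  apply: measurable_funM.
  - apply: (measurableT_comp mv (_ : measurable_fun setT
      (fun z : (T1 * T2) * T2 => (z.1.1, z.2)))).
    by apply: measurable_fun_pair => //; apply: measurableT_comp.
  - apply: (measurableT_comp mK2 (_ : measurable_fun setT
      (fun z : (T1 * T2) * T2 => (z.1.2, z.2)))).
    by apply: measurable_fun_pair => //; apply: measurableT_comp.
have iL x : integrableR (m1 \x m2)%E (fun t => v t * (K1 x.1 t.1 * K2 x.2 t.2)).
  apply: (integrableR_le (g := v)) => //.
  - apply: measurable_funM => //; apply: (measurableT_comp mK (_ : measurable_fun setT
      (fun t : T1 * T2 => (x, t)))).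
    exact: measurable_fun_pair.
  - by move=> t; rewrite normrM ler_piMr// normrM mulr_ile1.
have iv2 x' : integrableR (m1 \x m2)%E (fun t => v t * K2 x' t.2).
  apply: (integrableR_le (g := v)) => //.
  - apply: measurable_funM => //; apply: (measurableT_comp mK2 (_ : measurable_fun setT
      (fun t : T1 * T2 => (x', t.2)))).
    exact: measurable_fun_pair.
  - by move=> t; rewrite normrM ler_piMr.
pose L (x : T1 * T2) := \int[(m1 \x m2)%E]_t (v t * (K1 x.1 t.1 * K2 x.2 t.2)).
have LE x : L x = \int[m1]_t (H (t, x.2) * K1 x.1 t).
  rewrite /L Rintegral_prod//=; apply: Rintegral_ae_eq.
  - exact: (integrableR_mfun (integrableR_Rintegral1 (iL x))).
  - apply: measurable_funM.
    + by apply: (measurableT_comp mH); exact: measurable_fun_pair.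
    + by apply: (measurableT_comp mK1 (_ : measurable_fun setT (fun t => (x.1, t))));
        exact: measurable_fun_pair.
  (* Taking K1 out of the inner integral uses integrability of the section, known for almost every
     t. *)
  - apply: aeS (ae_integrableR1 (iv2 x.2)) => t it.
    rewrite /H -RintegralZr//; apply: eq_Rintegral => y _ /=.
    by rewrite mulrA mulrAC.
have mL : measurable_fun setT L.
  rewrite (funext LE); apply: (@measurable_Rintegral_param _ _ (T1 * T2)%type T1 R m1
    (fun u => H (u.2, u.1.2) * K1 u.1.1 u.2)).
  apply: measurable_funM.
  - apply: (measurableT_comp mH (_ : measurable_fun setT
      (fun z : (T1 * T2) * T1 => (z.2, z.1.2)))).
    by apply: measurable_fun_pair => //; apply: measurableT_comp.
  - apply: (measurableT_comp mK1 (_ : measurable_fun setT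
      (fun z : (T1 * T2) * T1 => (z.1.1, z.2)))).
    by apply: measurable_fun_pair => //; apply: measurableT_comp.
apply/(ae_prod_swap m1 m2 (measurable_neq0 mL)).
pose B t := ~ {ae m2, forall y, v (t, y) = 0}.
have vB : ~ {ae m1, forall t, ~ B t}.
  move=> h; apply: v0; apply/(ae_prod m1 m2 (measurable_eq0 mv)).
  by apply: aeS h => t /contrapT.
have mvt t : measurable [set y | v (t, y) = 0].
  have mvt : measurable_fun setT (fun y => v (t, y)) by exact: measurable_fun_pair2.
  exact: (measurable_eq0 mvt).
(* B is the set where the section of {v <> 0} has nonzero measure, and that measure depends
   measurably on t. *)
have mB : measurable [set t | B t].
  have mS : measurable [set z | v z != 0] by exact: measurable_neq0.
  have mS' := measurable_fun_xsection m2 mS.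
  rewrite (_ : [set t | B t] = setT `&` [set t | (m2 \o xsection [set z | v z != 0]) t != 0%E]).
    exact: emeasurable_neq.
  rewrite setTI; apply/seteqP; split=> t /=.
    move=> Bt; apply/eqP => S0; apply: Bt; apply/(ae_measure0P m2 (mvt t)).
    rewrite -S0; congr (m2 _); apply/seteqP.
    by split=> y; rewrite /xsection/= inE/= => /eqP.
  move=> /eqP S0 h; apply: S0; rewrite -[RHS]((ae_measure0P m2 (mvt t)).1 h).
  congr (m2 _); apply/seteqP.
  by split=> y; rewrite /xsection/= inE/= => /eqP.
have mQ : measurable [set z : T1 * T2 | B z.1 -> H z != 0].
  rewrite (_ : mkset _ = ~` (fst @^-1` [set t | B t]) `|` [set z | H z != 0]).
    apply: measurableU; last exact: measurable_neq0.
    by apply: measurableC; rewrite -[X in measurable X]setTI; exact: measurable_fst.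
  apply/seteqP; split=> z /=; last by case.
  by move=> h; have [/h|] := pselect (B z.1); [right|left].
have hQ : {ae m1, forall t, {ae m2, forall x', B t -> H (t, x') != 0}}.
  apply: aeS (ae_integrableR1 iv) => t it.
  have [Bt|nBt] := pselect (B t); last by apply: aeW => x' /nBt.
  by apply: aeS (K2n _ it Bt) => x' h _.
(* The two orders of Fubini exchange almost every t with almost every x'. *)
move/(ae_prod m1 m2 mQ)/(ae_prod_swap m1 m2 mQ) : hQ.
apply: aeS => x' hx'.
have iH : integrableR m1 (fun t => H (t, x')) by exact: (integrableR_Rintegral1 (iv2 x')).
have H0 : ~ {ae m1, forall t, H (t, x') = 0}.
  move=> H0; apply: vB; apply: aeS (ae_and hx' H0) => t [/= + Ht] Bt.
  by move=> /(_ Bt); rewrite Ht eqxx.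
by apply: aeS (K1n _ iH H0) => x0; rewrite LE.
Qed.

End nondegenerate_kernel.

(** * The Gaussian kernel in dimension d *)

Section leb_step_transport.
Context (R : realType) (n : nat).
Local Notation lam := (@lebesgue_measure R).
Local Notation nu := (leb R n).
Local Notation nu1 := (leb R n.+1).

Definition tuncons (y : Rd R n.+1) : measurableTypeR R * Rd R n :=
  (thead y, [tuple of behead y]).

Lemma tunconsK : cancel tuncons (@tcons R n).
Proof. by move=> y; rewrite /tcons/=; apply/val_inj => /=; case/tupleP: y => a u. Qed.

Lemma tnth_tcons0 u : tnth (@tcons R n u) ord0 = u.1.
Proof. by rewrite /tcons tnth0. Qed.

Lemma tnth_tconsS u i : tnth (@tcons R n u) (lift ord0 i) = tnth u.2 i.
Proof. by rewrite /tcons tnthS. Qed.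

Lemma measurable_tuncons : measurable_fun setT tuncons.
Proof.
apply: measurable_fun_pair; last exact: measurable_behead.
exact: (measurable_tnth ord0).
Qed.

Lemma measurable_tconsP d (T : measurableType d) (f : Rd R n.+1 -> T) :
  measurable_fun setT f <-> measurable_fun setT (f \o @tcons R n).
Proof.
split=> mf; first exact: measurableT_comp mf (@measurable_tcons R n).
have -> : f = (f \o @tcons R n) \o tuncons by apply/funext => y /=; rewrite tunconsK.
exact: measurableT_comp mf measurable_tuncons.
Qed.

Lemma ge0_integral_leb_step (f : Rd R n.+1 -> \bar R) : measurable_fun setT f ->
  (forall y, 0 <= f y)%E ->
  (\int[nu1]_y f y = \int[(lam \x nu)%E]_u f (tcons u))%E.
Proof.
move=> mf f0.
have := @ge0_integral_pushforward _ _ _ _ R (@tcons R n) (@measurable_tcons R n)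
  (lam \x nu)%E setT f measurableT mf (fun y _ => f0 y).
by rewrite preimage_setT => <-.
Qed.

Lemma integrableR_leb_step (f : Rd R n.+1 -> R) :
  integrableR nu1 f <-> integrableR (lam \x nu)%E (f \o @tcons R n).
Proof.
split=> fi.
  have mf := integrableR_mfun fi.
  apply/integrableP; split; first exact/measurable_EFinP/measurable_tconsP.
  case/integrableP: fi => mf' fi; apply: le_lt_trans fi.
  by rewrite ge0_integral_leb_step//; exact: measurableT_comp.
have mf : measurable_fun setT f by apply/measurable_tconsP; exact: integrableR_mfun fi.
case/integrableP: fi => mf' fi; apply/integrableP; split; first exact/measurable_EFinP.
by rewrite ge0_integral_leb_step//; do 2 apply: measurableT_comp => //.
Qed.

Lemma Rintegral_leb_step (f : Rd R n.+1 -> R) : integrableR nu1 f ->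
  \int[nu1]_y f y = \int[(lam \x nu)%E]_u f (tcons u).
Proof.
move=> fi; have fi' := (integrableR_leb_step f).1 fi; congr fine.
have := @integral_pushforward _ _ _ _ R (@tcons R n) (@measurable_tcons R n)
  (lam \x nu)%E setT (EFin \o f) (measurable_int _ fi) fi' measurableT.
by rewrite preimage_setT => <-.
Qed.

Lemma ae_leb_step (P : Rd R n.+1 -> Prop) : measurable [set y | P y] ->
  {ae nu1, forall y, P y} <-> {ae (lam \x nu)%E, forall u, P (tcons u)}.
Proof.
move=> mP.
have mP' : measurable [set u | P (tcons u)].
  by rewrite -[X in measurable X]setTI; exact: (@measurable_tcons R n measurableT _ mP).
have h1 := ae_measure0P nu1 mP.
have h2 := ae_measure0P (lam \x nu)%E mP'.
by split=> [/h1 h|/h2 h]; [apply/h2|apply/h1].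
Qed.

End leb_step_transport.

Section dkern.
Context {R : realType}.
Implicit Types c : R.

Definition dkern d c (x t : Rd R d) : R :=
  expR (- (c * \sum_(i < d) (tnth t i - 2 * tnth x i : R) ^+ 2)).

Lemma dkern_tcons n c (x t : measurableTypeR R * Rd R n) :
  dkern c (tcons x) (tcons t) = gker c x.1 t.1 * dkern c x.2 t.2.
Proof.
rewrite /dkern /gker -expRD; congr expR.
rewrite big_ord_recl !tnth_tcons0 mulrDr opprD; congr (_ - c * _).
by apply: eq_bigr => i _; rewrite !tnth_tconsS.
Qed.

Lemma dkern_gt0 d c (x t : Rd R d) : 0 < dkern c x t.
Proof. exact: expR_gt0. Qed.

Lemma dkern_le1 d c (x t : Rd R d) : 0 < c -> dkern c x t <= 1.
Proof.
move=> c0; rewrite -expR0 ler_expR oppr_le0; apply: mulr_ge0; first exact: ltW.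
by apply: sumr_ge0 => i _; exact: sqr_ge0.
Qed.

Lemma measurable_dkern d c : measurable_fun setT (fun z : Rd R d * Rd R d => dkern c z.1 z.2).
Proof.
apply: measurableT_comp => //; apply: measurableT_comp => //.
apply: measurable_funM => //; apply: measurable_sum => i.
apply: measurable_funX; apply: measurable_funB.
  by apply: (measurableT_comp (measurable_tnth i)).
by apply: measurable_funM => //; apply: (measurableT_comp (measurable_tnth i)).
Qed.

Lemma nondegenerate_gker c : 0 < c -> nondegenerate_kernel (@lebesgue_measure R) (gker c).
Proof.
move=> c0; split.
- apply: measurableT_comp => //; apply: measurableT_comp => //.
  apply: measurable_funM => //; apply: measurable_funX; apply: measurable_funB => //.
  exact: measurable_funM.
- move=> x t; rewrite ger0_norm ?expR_ge0// -expR0 ler_expR oppr_le0.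
  by rewrite mulr_ge0 ?sqr_ge0// ltW.
- by move=> v; exact: gker_integral_neq0.
Qed.

Lemma nondegenerate_dkern d c : 0 < c -> nondegenerate_kernel (leb R d) (dkern c).
Proof.
move=> c0; elim: d => [|n ih]; split; try exact: measurable_dkern.
- by move=> x t; rewrite ger0_norm ?dkern_le1// ltW// dkern_gt0.
(* In dimension 0 the measure is a Dirac mass, and the integral is the single value of v times a
   positive number. *)
- move=> v iv v0; apply: aeW => x; rewrite /Rintegral integral_dirac//=; last first.
    apply/measurable_EFinP/measurable_funM; first exact: integrableR_mfun iv.
    exact: (measurable_fun_pair2 x (measurable_dkern c)).
  rewrite indicT mul1r mulf_neq0//; last by rewrite gt_eqF// dkern_gt0.
  by apply/eqP => v00; apply: v0; apply: aeW => t; rewrite (tuple0 t).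
- by move=> x t; rewrite ger0_norm ?dkern_le1// ltW// dkern_gt0.
- move=> v iv v0; have mv := integrableR_mfun iv.
  have iL x : integrableR (leb R n.+1) (fun t => v t * dkern c x t).
    apply: (integrableR_le (g := v)) => //.
      by apply: measurable_funM => //; exact: (measurable_fun_pair2 x (measurable_dkern c)).
    by move=> t; rewrite normrM ler_piMr// ger0_norm ?dkern_le1// ltW// dkern_gt0.
  have mL : measurable_fun setT (fun x => \int[leb R n.+1]_t (v t * dkern c x t)).
    apply: (@measurable_Rintegral_param _ _ (Rd R n.+1) (Rd R n.+1) R (leb R n.+1)
      (fun u => v u.2 * dkern c u.1 u.2)).
    apply: measurable_funM; last exact: measurable_dkern.
    exact: measurableT_comp.
  apply/(ae_leb_step (measurable_neq0 mL)).
  have [_ _ K] := nondegenerate_kernel_prod (nondegenerate_gker c0) ih.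
  have v0' : ~ {ae (lebesgue_measure \x leb R n)%E, forall u, v (tcons u) = 0}.
    by move=> h; apply: v0; apply/(ae_leb_step (measurable_eq0 mv)).
  apply: aeS (K (v \o @tcons R n) ((integrableR_leb_step v).1 iv) v0') => u.
  rewrite Rintegral_leb_step//.
  by under eq_Rintegral do rewrite -dkern_tcons.
Qed.

End dkern.

(** * Translation invariance and Gaussian integrals *)

Section dot.
Context {R : realType} {d : nat}.
Local Notation E := (Rd R d).
Implicit Types x y : E.

Lemma measurable_dot d' (T : measurableType d') (f g : T -> E) :
  measurable_fun setT f -> measurable_fun setT g ->
  measurable_fun setT (fun t => dot (f t) (g t)).
Proof.
move=> mf mg; apply: measurable_sum => i; apply: measurable_funM.
  exact: (measurableT_comp (measurable_tnth i) mf).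
exact: (measurableT_comp (measurable_tnth i) mg).
Qed.

Lemma measurable_tsub d' (T : measurableType d') (f g : T -> E) :
  measurable_fun setT f -> measurable_fun setT g ->
  measurable_fun setT (fun t => tsub (f t) (g t)).
Proof.
move=> mf mg; apply/measurable_fun_tnthP => i.
rewrite (_ : _ \o _ = fun t => (tnth (f t) i : R) - (tnth (g t) i : R)).
  apply: measurable_funB.
    exact: (measurableT_comp (measurable_tnth i) mf).
  exact: (measurableT_comp (measurable_tnth i) mg).
by apply/funext => t; rewrite /= tnth_mktuple.
Qed.

(** With it the inverse of a translation is again of the form [tsub _ x]. *)
Definition topp x : E := [tuple - (tnth x i : R) | i < d].

Lemma tsubK x y : tsub (tsub y x) (topp x) = y.
Proof. by apply: eq_from_tnth => i; rewrite !tnth_mktuple opprK subrK. Qed.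

End dot.

Section translation.
Context {R : realType}.

Lemma lebesgue_measure_translation (a : R) (A : set R) : measurable A ->
  lebesgue_measure ((fun t : measurableTypeR R => t - a : measurableTypeR R) @^-1` A) =
  lebesgue_measure A.
Proof.
have mf : measurable_fun setT (fun t : measurableTypeR R => t - a : measurableTypeR R).
  exact: measurable_funB.
pose F (t : measurableTypeR R) : measurableTypeR R := t - a.
move=> mA; rewrite -[LHS]/(pushforward lebesgue_measure F A); apply/esym/lebesgue_measure_unique => //= _ [[b c]] _ <-.
rewrite /pushforward.
have -> : F @^-1` `]b, c] = `]b + a, c + a]%classic.
  by apply/seteqP; split => t /=; rewrite !in_itv/= ltrBrDr lerBlDr.
rewrite !lebesgue_measure_itv/= !lte_fin ltrD2r.
by case: ifP => // _; rewrite -!EFinB; congr EFin; ring.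
Qed.

Lemma integral_lebesgue_translation (a : R) (f : R -> \bar R) : measurable_fun setT f ->
  (forall t, 0 <= f t)%E ->
  (\int[lebesgue_measure]_t f (t - a)%R = \int[lebesgue_measure]_t f t)%E.
Proof.
move=> mf f0.
have mF : measurable_fun setT (fun t : measurableTypeR R => t - a : measurableTypeR R).
  exact: measurable_funB.
pose F (t : measurableTypeR R) : measurableTypeR R := t - a.
have := @ge0_integral_pushforward _ _ _ _ R F mF lebesgue_measure setT f measurableT mf
  (fun y _ => f0 y).
rewrite preimage_setT => <-; apply: eq_measure_integral => A mA _.
exact: lebesgue_measure_translation.
Qed.

Lemma tsub_tcons n (u x : measurableTypeR R * Rd R n) :
  tsub (tcons u) (tcons x) = tcons (u.1 - x.1 : R, tsub u.2 x.2).
Proof.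
apply: eq_from_tnth => i; rewrite tnth_mktuple.
by case: (unliftP ord0 i) => [j ->|->]; rewrite ?tnth_tconsS ?tnth_tcons0// tnth_mktuple.
Qed.

Lemma ge0_integral_tsub d (x : Rd R d) (f : Rd R d -> \bar R) : measurable_fun setT f ->
  (forall y, 0 <= f y)%E ->
  (\int[leb R d]_y f (tsub y x) = \int[leb R d]_y f y)%E.
Proof.
elim: d x f => [|n ih] x f mf f0.
  by apply: eq_integral => y _; rewrite (tuple0 (tsub y x)) (tuple0 y).
rewrite -(tunconsK x); move: (tuncons x) => {}x.
have mfc : measurable_fun setT (f \o @tcons R n) by exact/measurable_tconsP.
have mfx : measurable_fun setT (fun y => f (tsub y (tcons x))).
  by apply: (measurableT_comp mf); exact: measurable_tsub.
rewrite !ge0_integral_leb_step//.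
have mfxc : measurable_fun setT (fun u => f (tsub (tcons u) (tcons x))).
  exact: (measurable_tconsP (fun y => f (tsub y (tcons x)))).1.
rewrite (fubini_tonelli1 _ mfxc)// (fubini_tonelli1 _ mfc)// /fubini_F.
pose G t := (\int[leb R n]_y f (tcons (t, y)))%E.
transitivity (\int[lebesgue_measure]_t G (t - x.1)%R)%E.
  apply: eq_integral => t _; rewrite /G -[RHS](ih x.2 (fun y => f (tcons (t - x.1, y)))).
  - by apply: eq_integral => y _; rewrite tsub_tcons.
  - exact: (measurable_fun_pair2 _ mfc).
  - by [].
apply: (@integral_lebesgue_translation x.1 G).
  by apply: (measurable_fun_fubini_tonelli_F (f \o @tcons R n)) => //=.
by move=> t; exact: integral_ge0.
by move=> u; exact: f0.
Qed.

Lemma integral_tsub d (x : Rd R d) (f : Rd R d -> \bar R) : measurable_fun setT f ->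
  (\int[leb R d]_y f (tsub y x) = \int[leb R d]_y f y)%E.
Proof.
move=> mf; rewrite integralE [RHS]integralE; congr (_ - _)%E.
- rewrite -[RHS](ge0_integral_tsub x)//; last exact: measurable_funepos.
  by apply: eq_integral => y _; rewrite !funeposE.
- rewrite -[RHS](ge0_integral_tsub x)//; last exact: measurable_funeneg.
  by apply: eq_integral => y _; rewrite !funenegE.
Qed.

Lemma Rintegral_tsub d (x : Rd R d) (f : Rd R d -> R) : measurable_fun setT f ->
  \int[leb R d]_y f (tsub y x) = \int[leb R d]_y f y.
Proof.
move=> mf; congr fine; apply: (integral_tsub x (f := EFin \o f)).
exact/measurable_EFinP.
Qed.

Lemma integrableR_tsub d (x : Rd R d) (f : Rd R d -> R) : integrableR (leb R d) f ->
  integrableR (leb R d) (fun y => f (tsub y x)).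
Proof.
move=> fi; have mf := integrableR_mfun fi.
case/integrableP: fi => mf' fi; apply/integrableP; split.
  by apply/measurable_EFinP; apply: (measurableT_comp mf); exact: measurable_tsub.
rewrite (ge0_integral_tsub x (f := fun y => `|(f y)%:E|%E))//.
exact: measurableT_comp.
Qed.

End translation.

(** * The integral of a Gaussian over R^d *)

Section gaussian.
Context {R : realType}.

Definition gauss d (a : R) (y : Rd R d) : R := expR (- (a * dot y y)).

Lemma measurable_gauss d a : measurable_fun setT (@gauss d a).
Proof.
apply: measurableT_comp => //; apply: measurableT_comp => //.
by apply: measurable_funM => //; exact: measurable_dot.
Qed.

(** The integrand is a multiple of the centred normal density of variance 1 / (2a), which has total
    mass 1. *)
Lemma integral_gauss1 (a : R) : 0 < a ->
  (\int[lebesgue_measure]_t (expR (- (a * t ^+ 2)))%:E = (Num.sqrt (pi / a))%:E)%E.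
Proof.
move=> a0; pose s := Num.sqrt ((2 * a)^-1).
have s2 : s ^+ 2 = (2 * a)^-1 by rewrite sqr_sqrtr// invr_ge0 mulr_ge0// ltW.
have s0 : s != 0 by rewrite gt_eqF// sqrtr_gt0 invr_gt0 mulr_gt0.
have pk : normal_peak s = (Num.sqrt (pi / a))^-1.
  by rewrite /normal_peak s2; congr (Num.sqrt _)^-1; field; rewrite gt_eqF.
have p0 : Num.sqrt (pi / a) != 0 by rewrite gt_eqF// sqrtr_gt0 divr_gt0// pi_gt0.
have E t : normal_pdf 0 s t = (Num.sqrt (pi / a))^-1 * expR (- (a * t ^+ 2)).
  rewrite normal_pdfE// pk /normal_fun subr0 s2; congr (_ * expR _).
  by field; rewrite gt_eqF.
have := integral_normal_pdf 0 s.
under eq_integral do rewrite E EFinM.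
rewrite ge0_integralZl//; last first.
  apply/measurable_EFinP; apply: measurableT_comp => //; apply: measurableT_comp => //.
  by apply: measurable_funM => //; exact: measurable_funX.
move=> /(congr1 (fun x => (Num.sqrt (pi / a))%:E * x)%E).
by rewrite muleA -EFinM mulfV// mul1e mule1.
Qed.

Lemma integral_gauss d (a : R) : 0 < a ->
  (\int[leb R d]_y (gauss a y)%:E = (Num.sqrt (pi / a) ^+ d)%:E)%E.
Proof.
move=> a0; elim: d => [|n ih].
  rewrite integral_dirac//=; last by apply/measurable_EFinP; exact: measurable_gauss.
  by rewrite diracT mul1e /gauss /dot big_ord0 mulr0 oppr0 expR0 expr0.
have mg : measurable_fun setT (EFin \o @gauss n.+1 a).
  by apply/measurable_EFinP; exact: measurable_gauss.
have mgc := (measurable_tconsP _).1 mg.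
rewrite ge0_integral_leb_step//; last by move=> y; rewrite lee_fin expR_ge0.
rewrite (fubini_tonelli1 _ mgc)//; last by move=> y; rewrite lee_fin expR_ge0.
have E u : gauss a (@tcons R n u) = expR (- (a * u.1 ^+ 2)) * gauss a u.2.
  rewrite /gauss -expRD; congr expR.
  rewrite /dot big_ord_recl !tnth_tcons0 mulrDr opprD -expr2; congr (_ - a * _).
  by apply: eq_bigr => i _; rewrite !tnth_tconsS.
have F t : (\int[leb R n]_y ((EFin \o @gauss n.+1 a) \o @tcons R n) (t, y) =
    (expR (- (a * t ^+ 2)))%:E * (Num.sqrt (pi / a) ^+ n)%:E)%E.
  rewrite -ih -ge0_integralZl//.
  - by apply: eq_integral => y _; rewrite /= E EFinM.
  - by apply/measurable_EFinP; exact: measurable_gauss.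
  - by move=> y _; rewrite lee_fin expR_ge0.
rewrite /fubini_F; under eq_integral do rewrite F.
rewrite ge0_integralZr//; last first.
  apply/measurable_EFinP; apply: measurableT_comp => //; apply: measurableT_comp => //.
  by apply: measurable_funM => //; exact: measurable_funX.
by rewrite integral_gauss1// -EFinM exprS.
Qed.

Lemma integrableR_gauss d (a : R) : 0 < a -> integrableR (leb R d) (gauss a).
Proof.
move=> a0; apply/integrableP; split; first by apply/measurable_EFinP; exact: measurable_gauss.
under eq_integral do rewrite /= ger0_norm ?expR_ge0//.
by rewrite integral_gauss// ltry.
Qed.

End gaussian.

(** * The quadratic form of Id minus the projection on phi0 *)

Local Open Scope complex_scope.

Section complex_components.
Context {R : realType}.
Implicit Types a b c : R[i].

(** The squared modulus without the square root of [cabs], so that the estimates are polynomial in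
    the components. *)
Definition sqc c : R := complex.Re c ^+ 2 + complex.Im c ^+ 2.

Lemma sqc_ge0 c : 0 <= sqc c. Proof. by rewrite addr_ge0// sqr_ge0. Qed.

Lemma cabsE c : cabs c = Num.sqrt (sqc c).
Proof. by rewrite /cabs normc_def. Qed.

Lemma cabs_ge0 c : 0 <= cabs c. Proof. by rewrite cabsE sqrtr_ge0. Qed.

Lemma sqr_cabs c : cabs c ^+ 2 = sqc c.
Proof. by rewrite cabsE sqr_sqrtr// sqc_ge0. Qed.

Lemma sqc_eq0 c : (sqc c == 0) = (c == 0).
Proof.
case: c => x y; rewrite /sqc/= paddr_eq0 ?sqr_ge0// !sqrf_eq0.
by rewrite eq_complex.
Qed.

Lemma ReM a b : complex.Re (a * b) =
  complex.Re a * complex.Re b - complex.Im a * complex.Im b.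
Proof. by case: a b => [x y] [u v]. Qed.

Lemma ImM a b : complex.Im (a * b) =
  complex.Re a * complex.Im b + complex.Im a * complex.Re b.
Proof. by case: a b => [x y] [u v] /=; rewrite addrC. Qed.

Lemma ReB a b : complex.Re (a - b) = complex.Re a - complex.Re b.
Proof. by case: a b => [x y] [u v]. Qed.

Lemma ImB a b : complex.Im (a - b) = complex.Im a - complex.Im b.
Proof. by case: a b => [x y] [u v]. Qed.

Lemma ReJ c : complex.Re (conjc c) = complex.Re c. Proof. by case: c. Qed.
Lemma ImJ c : complex.Im (conjc c) = - complex.Im c. Proof. by case: c. Qed.

Definition ReImE := (ReB, ImB, ReM, ImM, ReJ, ImJ).

Lemma complex_ext a b : complex.Re a = complex.Re b -> complex.Im a = complex.Im b -> a = b.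
Proof. by case: a b => [x y] [u v] /= -> ->. Qed.

Lemma cisN (t : R) (a : R[i]) : cis t * (cis (- t) * a) = a.
Proof.
apply: complex_ext; rewrite !ReImE /cis/= cosN sinN.
- transitivity ((cos t ^+ 2 + sin t ^+ 2) * complex.Re a); first by ring.
  by rewrite cos2Dsin2 mul1r.
- transitivity ((cos t ^+ 2 + sin t ^+ 2) * complex.Im a); first by ring.
  by rewrite cos2Dsin2 mul1r.
Qed.

Lemma cisJ (t : R) (a b : R[i]) : (cis t * a) * conjc (cis t * b) = a * conjc b.
Proof.
apply: complex_ext; rewrite !ReImE /cis/=.
- transitivity ((cos t ^+ 2 + sin t ^+ 2) * complex.Re (a * conjc b)).
    by rewrite !ReImE; ring.
  by rewrite cos2Dsin2 mul1r !ReImE.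
- transitivity ((cos t ^+ 2 + sin t ^+ 2) * complex.Im (a * conjc b)).
    by rewrite !ReImE; ring.
  by rewrite cos2Dsin2 mul1r !ReImE.
Qed.

Lemma sqc_cis (t : R) (a : R[i]) : sqc (cis t * a) = sqc a.
Proof.
rewrite /sqc !ReImE /cis/=.
transitivity ((cos t ^+ 2 + sin t ^+ 2) * sqc a); first by rewrite /sqc; ring.
by rewrite cos2Dsin2 mul1r.
Qed.

End complex_components.

(** * The space L^2 and the unitary operators pi(z) *)

Section L2_theory.
Context {R : realType} {d : nat}.
Local Notation E := (Rd R d).
Local Notation C := R[i].
Local Notation mu := (leb R d).
Implicit Types (f g h : E -> C) (z : E * E) (x : E).

Definition cmeasurable f := measurable_fun setT (fun y => complex.Re (f y) : R) /\
  measurable_fun setT (fun y => complex.Im (f y) : R).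

Lemma measurable_sqc f : cmeasurable f -> measurable_fun setT (fun y => sqc (f y)).
Proof. by move=> [mr mi]; apply: measurable_funD; exact: measurable_funX. Qed.

Lemma Lnorm2E f : (L2norm f = (\int[mu]_y (sqc (f y))%:E) `^ 2^-1)%E.
Proof.
rewrite /L2norm Lnorm.unlock; congr poweR; apply: eq_integral => y _ /=.
by rewrite ger0_norm ?cabs_ge0// powR_mulrn ?cabs_ge0// sqr_cabs.
Qed.

Lemma L2P f : L2 f <-> cmeasurable f /\ integrableR mu (fun y => sqc (f y)).
Proof.
have E1 : (\int[mu]_y `|(EFin \o (fun y => sqc (f y))) y| = \int[mu]_y (sqc (f y))%:E)%E.
  by apply: eq_integral => y _ /=; rewrite ger0_norm// sqc_ge0.
rewrite /L2/= Lnorm2E; split=> [[mr mi fi]|[[mr mi] /integrableP[_]]]; last first.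
  by rewrite E1 => fi; split=> //; exact: poweR_lty.
split=> //; apply/integrableP; split; first by apply/measurable_EFinP; exact: measurable_sqc.
rewrite E1 ltey; apply/eqP => I.
by move: fi; rewrite I poweRyr// ltxx.
Qed.

Lemma L2_cmeasurable f : L2 f -> cmeasurable f. Proof. by move=> /L2P[]. Qed.

Definition nrm2 f : R := \int[mu]_y sqc (f y).

Lemma nrm2_ge0 f : 0 <= nrm2 f.
Proof. by apply: Rintegral_ge0 => y _; exact: sqc_ge0. Qed.

Lemma L2norm_sqr f : L2 f -> (L2norm f ^+ 2 = (nrm2 f)%:E)%E.
Proof.
move=> /L2P[_ fi]; rewrite Lnorm2E -EFin_Rintegral// -/(nrm2 f) poweR_EFin.
by rewrite -EFin_expe powR12_sqrt ?nrm2_ge0// sqr_sqrtr// nrm2_ge0.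
Qed.

Lemma nrm2_eq0 f : L2 f -> nrm2 f = 0 <-> {ae mu, forall y, f y = 0}.
Proof.
move=> /L2P[mf fi]; have mE : measurable_fun setT (fun y => (sqc (f y))%:E).
  by apply/measurable_EFinP; exact: measurable_sqc.
have := ge0_integral_eq0P mu mE (fun y => sqc_ge0 (f y)).
rewrite -EFin_Rintegral// -/(nrm2 f) => h; split.
- move=> f0; have : (nrm2 f)%:E = 0%E by rewrite f0.
  by move=> /h; apply: aeS => y [/eqP]; rewrite sqc_eq0 => /eqP.
- move=> f0; suff [] : (nrm2 f)%:E = 0%E by [].
  by apply/h; apply: aeS f0 => y ->; rewrite /sqc/= expr0n/= addr0.
Qed.

Lemma cmeasurable_mulJ f g : cmeasurable f -> cmeasurable g ->
  cmeasurable (fun y => f y * conjc (g y)).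
Proof.
move=> [fr fi] [gr gi]; split.
  under eq_fun do rewrite !ReImE.
  by apply: measurable_funB; apply: measurable_funM => //; exact: measurableT_comp.
under eq_fun do rewrite !ReImE.
by apply: measurable_funD; apply: measurable_funM => //; exact: measurableT_comp.
Qed.

(** A crude form of 2 |a| |b| <= |a|^2 + |b|^2, enough for the integrability of products. *)
Lemma Re_mulJ_le (a b : C) : `|complex.Re (a * conjc b)| <= sqc a + sqc b.
Proof.
rewrite !ReImE /sqc; case: a b => [x y] [u v] /=.
have := sqr_ge0 (x + u); have := sqr_ge0 (x - u); have := sqr_ge0 (y + v).
have := sqr_ge0 (y - v); rewrite ler_norml => *; apply/andP; split; nra.
Qed.

Lemma Im_mulJ_le (a b : C) : `|complex.Im (a * conjc b)| <= sqc a + sqc b.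
Proof.
rewrite !ReImE /sqc; case: a b => [x y] [u v] /=.
have := sqr_ge0 (x + v); have := sqr_ge0 (x - v); have := sqr_ge0 (y + u).
have := sqr_ge0 (y - u); rewrite ler_norml => *; apply/andP; split; nra.
Qed.

Lemma integrableR_mulJ f g : L2 f -> L2 g ->
  integrableR mu (fun y => complex.Re (f y * conjc (g y))) /\
  integrableR mu (fun y => complex.Im (f y * conjc (g y))).
Proof.
move=> /L2P[mf fi] /L2P[mg gi]; have [mr mi] := cmeasurable_mulJ mf mg.
split; apply: (integrableR_le (g := fun y => sqc (f y) + sqc (g y))) => //.
- exact: integrableRD.
- by move=> y; rewrite [leRHS]ger0_norm ?Re_mulJ_le// addr_ge0 ?sqc_ge0.
- exact: integrableRD.
- by move=> y; rewrite [leRHS]ger0_norm ?Im_mulJ_le// addr_ge0 ?sqc_ge0.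
Qed.

Lemma L2_subZ f g (c : C) : L2 f -> L2 g -> L2 (fun y => f y - c * g y).
Proof.
move=> /L2P[[fr fi] fs] /L2P[[gr gi] gs].
have m : cmeasurable (fun y => f y - c * g y).
  split; under eq_fun do rewrite !ReImE.
    by apply: measurable_funB => //; apply: measurable_funB; exact: measurable_funM.
  by apply: measurable_funB => //; apply: measurable_funD; exact: measurable_funM.
apply/L2P; split=> //.
apply: (integrableR_le (g := fun y => 2 * sqc (f y) + 2 * sqc c * sqc (g y))).
- exact: measurable_sqc.
- by apply: integrableRD; exact: integrableRZ.
- move=> y; rewrite !ger0_norm ?sqc_ge0//; last first.
    by rewrite addr_ge0// !mulr_ge0// sqc_ge0.
  rewrite /sqc !ReImE -subr_ge0.
  move: (complex.Re (f y)) (complex.Im (f y)) => x1 x2.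
  move: (complex.Re (g y)) (complex.Im (g y)) => y1 y2.
  move: (complex.Re c) (complex.Im c) => a b.
  (* Parallelogram identity: the difference is |f + c g|^2. *)
  have -> : 2 * (x1 ^+ 2 + x2 ^+ 2) + 2 * (a ^+ 2 + b ^+ 2) * (y1 ^+ 2 + y2 ^+ 2) -
    ((x1 - (a * y1 - b * y2)) ^+ 2 + (x2 - (a * y2 + b * y1)) ^+ 2) =
    (x1 + (a * y1 - b * y2)) ^+ 2 + (x2 + (a * y2 + b * y1)) ^+ 2 by ring.
  by rewrite addr_ge0// sqr_ge0.
Qed.

Lemma inner_subZ f g h (c : C) : L2 f -> L2 g -> L2 h ->
  inner (fun y => f y - c * g y) h = inner f h - c * inner g h.
Proof.
move=> Lf Lg Lh.
have [fr fi] := integrableR_mulJ Lf Lh; have [gr gi] := integrableR_mulJ Lg Lh.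
apply: complex_ext; rewrite !ReImE /=.
- rewrite -!RintegralZl// -RintegralB//; [|exact: integrableRZ|exact: integrableRZ].
  rewrite -RintegralB//; [|by apply: integrableRB; exact: integrableRZ].
  by apply: eq_Rintegral => y _; rewrite !ReImE; ring.
- rewrite -!RintegralZl// -RintegralD//; [|exact: integrableRZ|exact: integrableRZ].
  rewrite -RintegralB//; [|by apply: integrableRD; exact: integrableRZ].
  by apply: eq_Rintegral => y _; rewrite !ReImE; ring.
Qed.

Lemma innerJ f g : L2 f -> L2 g -> inner g f = conjc (inner f g).
Proof.
move=> Lf Lg; have [fr fi] := integrableR_mulJ Lf Lg.
apply: complex_ext; rewrite !ReImE /=.
  by apply: eq_Rintegral => y _; rewrite !ReImE; ring.
rewrite -mulN1r -RintegralZl//.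
by apply: eq_Rintegral => y _; rewrite !ReImE; ring.
Qed.

Lemma inner_diag f : inner f f = (nrm2 f)%:C.
Proof.
apply: complex_ext => /=.
  by apply: eq_Rintegral => y _; rewrite !ReImE /sqc; ring.
transitivity (\int[mu]_y (0 : R)); last by rewrite Rintegral_cst// mul0r.
by apply: eq_Rintegral => y _; rewrite !ReImE; ring.
Qed.

(** Common form of pi(z) and of its inverse, a translation followed by a unimodular factor. *)
Definition unimod (th : E -> R) x f : E -> C := fun y => cis (th y) * f (tsub y x).

Lemma cmeasurable_unimod th x f : measurable_fun setT th -> cmeasurable f ->
  cmeasurable (unimod th x f).
Proof.
move=> mth [mr mi].
have mt : measurable_fun setT (fun y : E => tsub y x) by exact: measurable_tsub.
have mr' := measurableT_comp mr mt; have mi' := measurableT_comp mi mt.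
have mc := measurableT_comp measurable_cos mth.
have ms := measurableT_comp measurable_sin mth.
split.
  have -> : (fun y => complex.Re (unimod th x f y)) = fun y =>
    cos (th y) * complex.Re (f (tsub y x)) - sin (th y) * complex.Im (f (tsub y x)).
    by apply/funext => y; rewrite /unimod ReM.
  by apply: measurable_funB; exact: measurable_funM.
have -> : (fun y => complex.Im (unimod th x f y)) = fun y =>
  cos (th y) * complex.Im (f (tsub y x)) + sin (th y) * complex.Re (f (tsub y x)).
  by apply/funext => y; rewrite /unimod ImM.
by apply: measurable_funD; exact: measurable_funM.
Qed.

Lemma L2_unimod th x f : measurable_fun setT th -> L2 f -> L2 (unimod th x f).
Proof.
move=> mth /L2P[mf fi]; apply/L2P; split; first exact: cmeasurable_unimod.
have := integrableR_tsub x fi; apply: eq_integrable => // y _ /=.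
by rewrite /unimod sqc_cis.
Qed.

Lemma inner_unimod th x f g : cmeasurable f -> cmeasurable g ->
  inner (unimod th x f) (unimod th x g) = inner f g.
Proof.
move=> mf mg; have [mr mi] := cmeasurable_mulJ mf mg.
apply: complex_ext => /=.
  rewrite -[RHS](Rintegral_tsub x mr).
  by apply: eq_Rintegral => y _; rewrite /unimod cisJ.
rewrite -[RHS](Rintegral_tsub x mi).
by apply: eq_Rintegral => y _; rewrite /unimod cisJ.
Qed.

Lemma measurable_modulation z : measurable_fun setT (fun y => 2 * pi * dot z.2 y : R).
Proof. by apply: measurable_funM => //; exact: measurable_dot. Qed.

Lemma L2_tfshift z f : L2 f -> L2 (tfshift z f).
Proof. by move=> Lf; apply: (L2_unimod z.1 (measurable_modulation z)). Qed.

Lemma inner_tfshift z f g : L2 f -> L2 g -> inner (tfshift z f) (tfshift z g) = inner f g.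
Proof.
move=> /L2_cmeasurable mf /L2_cmeasurable mg.
exact: (inner_unimod (fun y => 2 * pi * dot z.2 y) z.1 mf mg).
Qed.

(** The explicit inverse of pi(z): f(y + x) with the phase -2 pi xi.(y + x). *)
Definition tfshiftV z f : E -> C :=
  unimod (fun y => - (2 * pi * dot z.2 (tsub y (topp z.1)))) (topp z.1) f.

Lemma L2_tfshiftV z f : L2 f -> L2 (tfshiftV z f).
Proof.
have mth : measurable_fun setT (fun y : E => - (2 * pi * dot z.2 (tsub y (topp z.1)))).
  apply: measurableT_comp => //; apply: measurable_funM => //.
  by apply: measurable_dot => //; exact: measurable_tsub.
exact: (L2_unimod (topp z.1) mth).
Qed.

Lemma tfshiftVK z f : tfshift z (tfshiftV z f) = f.
Proof. by apply/funext => y; rewrite /tfshift /tfshiftV /unimod tsubK cisN. Qed.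

Lemma is_adjoint_tfshiftV z : is_adjoint (tfshift z) (tfshiftV z).
Proof.
split=> [g|f g Lf Lg]; first exact: L2_tfshiftV.
by rewrite -{1}(tfshiftVK z g) inner_tfshift//; exact: L2_tfshiftV.
Qed.

(** The explicit inverse is a witness, so the choice does not fall back on its default value. *)
Lemma is_adjoint_adjoint z : is_adjoint (tfshift z) (adjoint (tfshift z)).
Proof.
exact: (xgetPex (P := [set T | is_adjoint (tfshift z) T]) _ (ex_intro _ _ (is_adjoint_tfshiftV z))).
Qed.

End L2_theory.

(** * The projection on the normalised Gaussian *)

Section phi0.
Context {R : realType} {d : nat}.
Local Notation E := (Rd R d).
Local Notation C := R[i].
Local Notation mu := (leb R d).
Local Notation phi0 := (@phi0 R d).
Implicit Types (f : E -> C) (z : E * E).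

Lemma sqc_phi0 t : sqc (phi0 t) = 2 `^ (d%:R / 2) * gauss (2 * pi) t.
Proof.
rewrite /sqc /phi0/= expr0n/= addr0 exprMn; congr (_ * _).
  rewrite expr2 -powRD; last by rewrite pnatr_eq0 implybT.
  by congr (_ `^ _); field.
by rewrite expr2 -expRD /gauss; congr expR; ring.
Qed.

Lemma L2_phi0 : L2 phi0.
Proof.
apply/L2P; split; first split.
- apply: measurable_funM => //; apply: measurableT_comp => //.
  by apply: measurable_funM => //; exact: measurable_dot.
- exact: measurable_cst.
- have pi2 : 0 < 2 * pi :> R by rewrite mulr_gt0// pi_gt0.
  have := integrableRZ (2 `^ (d%:R / 2)) (integrableR_gauss d pi2).
  by apply: eq_integrable => // t _ /=; rewrite sqc_phi0.
Qed.

Lemma nrm2_phi0 : nrm2 phi0 = 1.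
Proof.
have pi2 : 0 < 2 * pi :> R by rewrite mulr_gt0// pi_gt0.
rewrite /nrm2; under eq_Rintegral do rewrite sqc_phi0.
rewrite RintegralZl//; last exact: integrableR_gauss.
rewrite /Rintegral integral_gauss//=.
have p0 : pi != 0 :> R by rewrite gt_eqF// pi_gt0.
have -> : pi / (2 * pi) = 2^-1 :> R by rewrite invfM mulrCA mulfV// mulr1.
rewrite (mulrC d%:R) powRrM powR_mulrn ?powR_ge0// powR12_sqrt// -exprMn -sqrtrM//.
by rewrite mulfV// sqrtr1 expr1n.
Qed.

Definition stft f z : C := inner f (tfshift z phi0).

Lemma inner_phi0 : inner phi0 phi0 = 1.
Proof. by rewrite inner_diag nrm2_phi0. Qed.

(* The adjoint is only known through its defining property, but that suffices:
   A f enters through inner products with functions of the range of pi(z). *)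
Lemma Qfun_S0E f z : L2 f ->
  Qfun (@S0 R d) f z = (nrm2 f - sqc (stft f z))%:C /\ sqc (stft f z) <= nrm2 f.
Proof.
move=> Lf; rewrite /Qfun /alpha; set A := adjoint _.
have [AL AE] := is_adjoint_adjoint z; rewrite -/A in AL AE.
have LAf := AL _ Lf; have LU := L2_tfshift z L2_phi0.
have c : inner (A f) phi0 = stft f z.
  by rewrite (innerJ L2_phi0 LAf) -(AE _ _ L2_phi0 Lf) -innerJ.
(* The chosen adjoint preserves the norm: pairing A f with the explicit inverse applied to f
   evaluates to <f, f>. *)
have AA : inner (A f) (A f) = (nrm2 f)%:C.
  have LB := L2_tfshiftV z Lf; have [_ BE] := is_adjoint_tfshiftV z.
  rewrite -(AE _ _ LAf Lf) (BE _ _ LAf Lf) (innerJ LB LAf) -(AE _ _ LB Lf).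
  by rewrite tfshiftVK inner_diag conjc_real.
have S0E : S0 (A f) = fun y => A f y - stft f z * phi0 y.
  by apply/funext => y; rewrite /S0 /rank_one c.
have LS : L2 (S0 (A f)) by rewrite S0E; exact: L2_subZ LAf L2_phi0.
have pA : inner phi0 (A f) = conjc (stft f z) by rewrite (innerJ LAf L2_phi0) c.
have Q : inner (S0 (A f)) (A f) = (nrm2 f - sqc (stft f z))%:C.
  rewrite S0E inner_subZ//; last exact: L2_phi0.
  rewrite AA pA; case: (stft f z) => a b.
  by apply: complex_ext; rewrite !ReImE/= /sqc/=; ring.
split; first by rewrite (AE _ _ LS Lf).
(* [S0] is an orthogonal projection, so the quadratic form is the squared norm of S0 (A f); its sign
   is Bessel's inequality. *)
have : inner (S0 (A f)) (S0 (A f)) = (nrm2 f - sqc (stft f z))%:C.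
  rewrite {1}S0E inner_subZ//; last exact: L2_phi0.
  rewrite (innerJ LS LAf) Q conjc_real.
  rewrite (innerJ LS L2_phi0) {1}S0E inner_subZ//; last exact: L2_phi0.
  2: exact: L2_phi0.
  by rewrite c inner_phi0 mulr1 subrr conjc0 mulr0 subr0.
rewrite inner_diag => /(congr1 (@complex.Re R))/= h.
by rewrite -subr_ge0 -h nrm2_ge0.
Qed.

End phi0.

(** * Zeros of the short-time Fourier transform *)

Section phase_space.
Context {R : realType} {d : nat}.
Local Notation E := (Rd R d).
Local Notation mu := (leb R d).

Lemma measurable_phase_space (A : set (E * E)) : measurable A ->
  measurable (A : set (phase_space R d)).
Proof.
by move=> mA; apply: sub_caratheodory; exact: sub_sigma_algebra.
Qed.

Lemma vol_prod (A : set (E * E)) : measurable A -> vol R d A = (mu \x mu)%E A.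
Proof. by move=> mA; rewrite /vol/= /completed_measure_extension/= measurable_mu_extE. Qed.

Lemma measurable_fun_phase_space d' (T : measurableType d') (f : E * E -> T) :
  measurable_fun setT f -> measurable_fun setT (f : phase_space R d -> T).
Proof.
move=> mf _ Y mY; rewrite setTI; apply: measurable_phase_space.
by rewrite -[X in measurable X]setTI; exact: mf.
Qed.

(** Fubini yields statements about the Borel product, while Omega is measurable only for its
    completion. *)
Lemma ae_vol (P : E * E -> Prop) : measurable [set z | P z] ->
  {ae (mu \x mu)%E, forall z, P z} -> {ae vol R d, forall z, P z}.
Proof.
move=> mP /(ae_measure0P (mu \x mu)%E mP) h.
apply/(ae_measure0P (vol R d) (measurable_phase_space mP)).
by rewrite -h; apply: vol_prod; exact: measurableC.
Qed.

End phase_space.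

(** * The transform as a pair of real Gaussian integrals *)

Section stft_formula.
Context {R : realType} {d : nat}.
Local Notation E := (Rd R d).
Local Notation C := R[i].
Local Notation mu := (leb R d).
Implicit Types (f : E -> C) (z : E * E).

(* Real and imaginary parts of f(y) exp(-2 i pi xi.y). *)
Definition modRe f (xi y : E) : R := complex.Re (f y) * cos (2 * pi * dot xi y) +
  complex.Im (f y) * sin (2 * pi * dot xi y).

Definition modIm f (xi y : E) : R := complex.Im (f y) * cos (2 * pi * dot xi y) -
  complex.Re (f y) * sin (2 * pi * dot xi y).

(** The translate of phi0 by x; it is real, so it does not mix real and imaginary parts. *)
Definition amp (x y : E) : R :=
  2 `^ (d%:R / 4) * expR (- pi * dot (tsub y x) (tsub y x)).

Lemma Re_stft f z : complex.Re (stft f z) = \int[mu]_y (modRe f z.2 y * amp z.1 y).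
Proof.
apply: eq_Rintegral => y _; rewrite /tfshift /phi0 /cis !ReImE/= /modRe /amp; ring.
Qed.

Lemma Im_stft f z : complex.Im (stft f z) = \int[mu]_y (modIm f z.2 y * amp z.1 y).
Proof.
apply: eq_Rintegral => y _; rewrite /tfshift /phi0 /cis !ReImE/= /modIm /amp; ring.
Qed.

Lemma measurable_modulation_pair :
  measurable_fun setT (fun u : E * E => 2 * pi * dot u.1 u.2 : R).
Proof. by apply: measurable_funM => //; exact: measurable_dot. Qed.

Lemma measurable_modRe f : cmeasurable f -> measurable_fun setT (fun u : E * E => modRe f u.1 u.2).
Proof.
move=> [mr mi]; apply: measurable_funD; apply: measurable_funM.
- exact: (measurableT_comp mr measurable_snd).
- exact: (measurableT_comp measurable_cos measurable_modulation_pair).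
- exact: (measurableT_comp mi measurable_snd).
- exact: (measurableT_comp measurable_sin measurable_modulation_pair).
Qed.

Lemma measurable_modIm f : cmeasurable f -> measurable_fun setT (fun u : E * E => modIm f u.1 u.2).
Proof.
move=> [mr mi]; apply: measurable_funB; apply: measurable_funM.
- exact: (measurableT_comp mi measurable_snd).
- exact: (measurableT_comp measurable_cos measurable_modulation_pair).
- exact: (measurableT_comp mr measurable_snd).
- exact: (measurableT_comp measurable_sin measurable_modulation_pair).
Qed.

Lemma measurable_amp : measurable_fun setT (fun u : E * E => amp u.1 u.2).
Proof.
apply: measurable_funM => //; apply: measurableT_comp => //; apply: measurable_funM => //.
by apply: measurable_dot; exact: measurable_tsub.
Qed.

Lemma measurable_amp_integral (g : E -> E -> R) :
  measurable_fun setT (fun u : E * E => g u.1 u.2) ->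
  measurable_fun setT (fun z : E * E => \int[mu]_y (g z.2 y * amp z.1 y)).
Proof.
move=> mg; apply: (@measurable_Rintegral_param _ _ (E * E)%type E R mu
  (fun u => g u.1.2 u.2 * amp u.1.1 u.2)).
apply: measurable_funM.
  apply: (measurableT_comp mg (_ : measurable_fun setT
    (fun u : (E * E) * E => (u.1.2, u.2)))).
  by apply: measurable_fun_pair => //; exact: measurableT_comp.
apply: (measurableT_comp measurable_amp (_ : measurable_fun setT
  (fun u : (E * E) * E => (u.1.1, u.2)))).
by apply: measurable_fun_pair => //; exact: measurableT_comp.
Qed.

Lemma measurable_sqc_stft f : cmeasurable f ->
  measurable_fun setT (fun z : E * E => sqc (stft f z)).
Proof.
move=> mf; rewrite /sqc; under eq_fun do rewrite Re_stft Im_stft.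
apply: measurable_funD; apply: measurable_funX; apply: measurable_amp_integral.
  exact: measurable_modRe.
exact: measurable_modIm.
Qed.

(** |y - x|^2 = |y|^2 / 2 + |y - 2x|^2 / 2 - |x|^2. Half of the Gaussian makes an L^2 function
    integrable, and the other half is the bounded kernel centred at 2x. *)
Lemma ampE x y : amp x y =
  2 `^ (d%:R / 4) * expR (pi * dot x x) * (gauss (pi / 2) y * dkern (pi / 2) x y).
Proof.
rewrite /amp -mulrA; congr (_ * _); rewrite /gauss /dkern -!expRD; congr expR.
rewrite /dot !mulr_sumr -!sumrN -!big_split/=; apply: eq_bigr => i _.
by rewrite !tnth_mktuple; field.
Qed.

Lemma modRe_modIm_eq0 f xi y : modRe f xi y = 0 -> modIm f xi y = 0 -> f y = 0.
Proof.
rewrite /modRe /modIm; case: (f y) => a b /=; set t := 2 * pi * _ => h1 h2.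
have cs := cos2Dsin2 t; apply: complex_ext => /=.
  transitivity (cos t * (a * cos t + b * sin t) - sin t * (b * cos t - a * sin t)).
    by transitivity (a * (cos t ^+ 2 + sin t ^+ 2)); [rewrite cs mulr1|ring].
  by rewrite h1 h2 !mulr0 subr0.
transitivity (sin t * (a * cos t + b * sin t) + cos t * (b * cos t - a * sin t)).
  by transitivity (b * (cos t ^+ 2 + sin t ^+ 2)); [rewrite cs mulr1|ring].
by rewrite h1 h2 !mulr0 addr0.
Qed.

Lemma integrableR_mod_gauss f (m : E -> R) : L2 f -> measurable_fun setT m ->
  (forall y, m y ^+ 2 <= sqc (f y)) ->
  integrableR mu (fun y => m y * gauss (pi / 2) y).
Proof.
move=> /L2P[_ fi] mm mf; have p0 : 0 < pi :> R := pi_gt0 R.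
apply: (integrableR_le (g := fun y => sqc (f y) + gauss pi y)).
- by apply: measurable_funM => //; exact: measurable_gauss.
- by apply: integrableRD => //; exact: integrableR_gauss.
- move=> y; rewrite [leRHS]ger0_norm; last by rewrite addr_ge0 ?sqc_ge0// expR_ge0.
  have -> : gauss pi y = gauss (pi / 2) y ^+ 2 :> R.
    by rewrite expr2 /gauss -expRD; congr expR; field.
  have := mf y; set a := m y; set s := sqc (f y); set g := gauss (pi / 2) y => h.
  have := sqr_ge0 (a - g); have := sqr_ge0 (a + g).
  by rewrite ler_norml => *; apply/andP; split; nra.
Qed.

Lemma modRe_sqr_le f xi y : modRe f xi y ^+ 2 <= sqc (f y).
Proof.
rewrite -subr_ge0 /modRe /sqc; case: (f y) => a b /=; set t := 2 * pi * _.
rewrite -[X in X - _]mulr1 -(cos2Dsin2 t).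
have -> : (a ^+ 2 + b ^+ 2) * (cos t ^+ 2 + sin t ^+ 2) - (a * cos t + b * sin t) ^+ 2 =
  (b * cos t - a * sin t) ^+ 2 by ring.
exact: sqr_ge0.
Qed.

Lemma modIm_sqr_le f xi y : modIm f xi y ^+ 2 <= sqc (f y).
Proof.
rewrite -subr_ge0 /modIm /sqc; case: (f y) => a b /=; set t := 2 * pi * _.
rewrite -[X in X - _]mulr1 -(cos2Dsin2 t).
have -> : (a ^+ 2 + b ^+ 2) * (cos t ^+ 2 + sin t ^+ 2) - (b * cos t - a * sin t) ^+ 2 =
  (a * cos t + b * sin t) ^+ 2 by ring.
exact: sqr_ge0.
Qed.

Lemma amp_integral_neq0 f (m : E -> R) : L2 f -> measurable_fun setT m ->
  (forall y, m y ^+ 2 <= sqc (f y)) -> ~ {ae mu, forall y, m y = 0} ->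
  {ae mu, forall x, \int[mu]_y (m y * amp x y) != 0}.
Proof.
move=> Lf mm mf m0; have p2 : 0 < pi / 2 :> R by rewrite divr_gt0// pi_gt0.
have im := integrableR_mod_gauss Lf mm mf.
have [_ Kb K] := nondegenerate_dkern d p2.
have w0 : ~ {ae mu, forall y, m y * gauss (pi / 2) y = 0}.
  move=> h; apply: m0; apply: aeS h => y /eqP.
  by rewrite mulf_eq0 orbC gt_eqF ?expR_gt0//= => /eqP.
apply: aeS (K _ im w0) => x Lx.
have iK : integrableR mu (fun y => m y * gauss (pi / 2) y * dkern (pi / 2) x y).
  apply: (integrableR_le (g := fun y => m y * gauss (pi / 2) y)) => //.
    apply: measurable_funM; first exact: integrableR_mfun im.
    exact: (measurable_fun_pair2 x (measurable_dkern (pi / 2))).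
  by move=> y; rewrite normrM ler_piMr.
have -> : \int[mu]_y (m y * amp x y) = 2 `^ (d%:R / 4) * expR (pi * dot x x) *
    \int[mu]_y (m y * gauss (pi / 2) y * dkern (pi / 2) x y).
  by rewrite -RintegralZl//; apply: eq_Rintegral => y _; rewrite ampE; ring.
by rewrite mulf_neq0// gt_eqF// mulr_gt0 ?expR_gt0// powR_gt0.
Qed.

(** For every xi, [modRe] and [modIm] cannot both vanish almost everywhere, since together they
    determine f; whichever does not gives a component of V(., xi) that is nonzero for almost every
    x. *)
Lemma stft_neq0 f : L2 f -> ~ {ae mu, forall y, f y = 0} ->
  {ae (mu \x mu)%E, forall z, sqc (stft f z) != 0}.
Proof.
move=> Lf f0; have mf := L2_cmeasurable Lf.
have mS : measurable [set z : E * E | sqc (stft f z) != 0].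
  exact: (measurable_neq0 (measurable_sqc_stft mf)).
apply/(ae_prod_swap mu mu mS)/aeW => xi.
have mRe : measurable_fun setT (modRe f xi) by exact: (measurable_fun_pair2 xi (measurable_modRe mf)).
have mIm : measurable_fun setT (modIm f xi) by exact: (measurable_fun_pair2 xi (measurable_modIm mf)).
have [r0|r0] := pselect {ae mu, forall y, modRe f xi y = 0}; last first.
  apply: aeS (amp_integral_neq0 Lf mRe (modRe_sqr_le f xi) r0) => x.
  rewrite -(Re_stft f (x, xi)) /sqc; apply: contra => /eqP/eqP.
  by rewrite paddr_eq0 ?sqr_ge0// !sqrf_eq0 => /andP[].
have i0 : ~ {ae mu, forall y, modIm f xi y = 0}.
  move=> i0; apply: f0; apply: aeS (ae_and r0 i0) => y [].
  exact: modRe_modIm_eq0.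
apply: aeS (amp_integral_neq0 Lf mIm (modIm_sqr_le f xi) i0) => x.
rewrite -(Im_stft f (x, xi)) /sqc; apply: contra => /eqP/eqP.
by rewrite paddr_eq0 ?sqr_ge0// !sqrf_eq0 => /andP[].
Qed.

End stft_formula.

(** * Bounds for the ratio *)

Section power_bounds.
Context {R : realType}.
Implicit Types p s : R.

(** Bernoulli's inequality for an integer exponent above p, as (1 - s)^p decreases in p. The case s
    = 1 is apart because comparing exponents uses a positive base. *)
Lemma powR_onem_ge p s : 0 <= s <= 1 -> 1 <= p ->
  1 - (Num.truncn p).+1%:R * s <= (1 - s) `^ p.
Proof.
move=> /andP[s0 s1] p1; set k := (Num.truncn p).+1.
have [s1'|s1'] := eqVneq s 1.
  apply: le_trans (powR_ge0 _ _); rewrite s1' mulr1 subr_le0.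
  by rewrite ler1n.
apply: (@le_trans _ _ ((1 - s) ^+ k)); first by rewrite bernoulli_ge// s0.
rewrite -powR_mulrn ?subr_ge0//; apply: ger_powR.
  by rewrite subr_gt0 lt_neqAle s1' s1/= gerBl.
by apply: ltW; exact: truncnS_gt.
Qed.

Lemma powR_onem_le1 p s : 0 <= s <= 1 -> 0 <= p -> (1 - s) `^ p <= 1.
Proof.
move=> /andP[s0 s1] p0; have : (1 - s) `^ p <= 1 `^ p.
  by apply: ge0_ler_powR; rewrite ?nnegrE ?subr_ge0// gerBl.
by rewrite powR1.
Qed.

End power_bounds.

Lemma integrable_cst_lty d (T : measurableType d) (R : realType)
    (mu : {measure set T -> \bar R}) (D : set T) (c : R) :
  measurable D -> (mu D < +oo)%E -> mu.-integrable D (cst c%:E).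
Proof.
move=> mD Dy; apply/integrableP; split=> //.
rewrite (_ : (fun _ => _) = cst `|c|%:E)// integral_cst//.
by apply: lte_mul_pinfty => //; rewrite lee_fin.
Qed.

(** * The strict upper bound *)

Section Qratio.
Context {R : realType} {d : nat} (p : R) (Omega : set (phase_space R d)).
Local Notation E := (Rd R d).
Local Notation C := R[i].
Local Notation mu := (leb R d).
Local Notation vol := (vol R d).
Hypotheses (p1 : 1 <= p) (mO : measurable Omega).
Hypotheses (O0 : (0 < vol Omega)%E) (Oy : (vol Omega < +oo)%E).
Implicit Types (f : E -> C).

Let p0 : 0 < p. Proof. exact: lt_le_trans p1. Qed.

Let v0 : R := fine (vol Omega).

Let volE : vol Omega = v0%:E.
Proof. by rewrite fineK// ge0_fin_numE. Qed.

Let v0_gt0 : 0 < v0. Proof. by rewrite -lte_fin -volE. Qed.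

Definition Qpow f : phase_space R d -> R := fun z => (nrm2 f - sqc (stft f z)) `^ p.

Lemma measurable_Qpow f : L2 f -> measurable_fun setT (Qpow f).
Proof.
move=> Lf; apply: (measurableT_comp (measurable_powR p)).
apply: (@measurable_fun_phase_space R d _ (measurableTypeR R)
  (fun z => nrm2 f - sqc (stft f z))).
by apply: measurable_funB => //; apply: measurable_sqc_stft; exact: L2_cmeasurable.
Qed.

Lemma Qpow_itv f z : L2 f -> 0 <= Qpow f z <= nrm2 f `^ p.
Proof.
move=> Lf; have [_ h] := Qfun_S0E z Lf; rewrite powR_ge0/=.
apply: ge0_ler_powR; rewrite ?nnegrE ?subr_ge0 ?nrm2_ge0//; first exact: ltW.
by rewrite gerBl sqc_ge0.
Qed.

Lemma integrable_Qpow f : L2 f -> vol.-integrable Omega (EFin \o Qpow f).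
Proof.
move=> Lf; apply: (@le_integrable _ _ _ _ _ _ _ (cst (nrm2 f `^ p)%:E)) => //.
- by apply/measurable_EFinP; apply: measurable_funS (measurable_Qpow Lf).
- move=> z _ /=; have /andP[h1 h2] := Qpow_itv z Lf.
  by rewrite lee_fin !ger0_norm ?powR_ge0.
exact: integrable_cst_lty.
Qed.

Lemma QratioE f : L2_nonzero f -> 0 < nrm2 f /\
  Qratio p Omega f = ((\int[vol]_(z in Omega) Qpow f z) `^ p^-1 * (nrm2 f)^-1)%:E.
Proof.
move=> [Lf f0].
have N0 : 0 < nrm2 f by rewrite lt_neqAle nrm2_ge0 andbT eq_sym; apply/eqP => /(nrm2_eq0 Lf).
split=> //; rewrite /Qratio L2norm_sqr// inver gt_eqF// EFinM; congr (_ * _)%E.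
rewrite /Lpnorm Lnorm.unlock -poweR_EFin; congr poweR.
rewrite /Rintegral fineK; last exact: (integrable_fin_num mO (integrable_Qpow Lf)).
rewrite [RHS]integral_mkcond; apply: eq_integral => z _.
(* Outside Omega the restricted function is 0, and 0^p = 0 because p > 0. *)
rewrite !patchE; case: ifPn => _; last by rewrite abse0 poweR0r// gt_eqF.
have [-> h] := Qfun_S0E z Lf.
rewrite cabsE /sqc/= expr0n/= addr0 sqrtr_sqr normr_id ger0_norm ?subr_ge0//.
Qed.

Lemma Qratio_lt f : L2_nonzero f -> (Qratio p Omega f < (vol Omega) `^ p^-1)%E.
Proof.
move=> Lf; have [N0 ->] := QratioE Lf; have [{}Lf f0] := Lf.
rewrite volE poweR_EFin lte_fin ltr_pdivrMr//.
have -> : v0 `^ p^-1 * nrm2 f = (v0 * nrm2 f `^ p) `^ p^-1.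
  by rewrite powRM ?powR_ge0 ?ltW// -powRrM mulfV ?gt_eqF// powRr1// ltW.
apply: gt0_ltr_powR; rewrite ?invr_gt0//.
- by rewrite nnegrE Rintegral_ge0// => z _; exact: powR_ge0.
- by rewrite nnegrE mulr_ge0 ?powR_ge0// ltW.
have iQ := integrable_Qpow Lf.
have ic : vol.-integrable Omega (EFin \o (fun=> nrm2 f `^ p)).
  exact: integrable_cst_lty.
rewrite mulrC -(Rintegral_cst vol mO) -subr_gt0 -RintegralB//.
set D := fun z => nrm2 f `^ p - Qpow f z.
have D0 z : 0 <= D z by rewrite subr_ge0; have /andP[] := Qpow_itv z Lf.
rewrite lt_neqAle Rintegral_ge0 ?andbT; last by move=> z _; exact: D0.
rewrite eq_sym; apply/eqP => I0.
have iD : vol.-integrable Omega (EFin \o D).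
  by have := integrableB mO ic iQ; apply: eq_integrable.
have mD : measurable_fun Omega (EFin \o D) by exact: measurable_int iD.
have : (\int[vol]_(z in Omega) `|(EFin \o D) z| = 0)%E.
  rewrite -[RHS]/(0%:E) -[in RHS]I0 fineK; last exact: integrable_fin_num.
  by apply: eq_integral => z _ /=; rewrite ger0_norm.
move=> /(ae_eq_integral_abs vol mO mD) Dae.
have Sae : {ae vol, forall z, sqc (stft f z) != 0}.
  apply: ae_vol (stft_neq0 Lf f0).
  exact: (measurable_neq0 (measurable_sqc_stft (L2_cmeasurable Lf))).
have : {ae vol, forall z, ~ Omega z}.
  apply: aeS (ae_and Dae Sae) => z [+ Sz] Oz => /(_ Oz)[/eqP].
  rewrite subr_eq0 => /eqP /(powR_injective p0).
  rewrite !nnegrE nrm2_ge0 subr_ge0 (Qfun_S0E z Lf).2 => /(_ isT isT) h.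
  by move/eqP: Sz; apply; lra.
have mOc : measurable [set z | ~ Omega z] by exact: measurableC.
move=> Oae; have := (ae_measure0P vol mOc).1 Oae.
have -> : [set z | ~ (~ Omega z)] = Omega.
  by apply/seteqP; split=> [z /contrapT//|z Oz nOz]; exact: nOz.
by move=> h; move: O0; rewrite h ltxx.
Qed.

End Qratio.

(** * Translated Gaussians *)

Section gaussian_sequence.
Context {R : realType} {d : nat}.
Local Notation E := (Rd R d).
Local Notation C := R[i].
Local Notation mu := (leb R d).
Implicit Types (a x y : E).

Definition shifted_phi0 a : E -> C := tfshift (a, [tuple 0 | i < d]) (@phi0 R d).

Lemma L2_shifted_phi0 a : L2 (shifted_phi0 a).
Proof. exact: L2_tfshift L2_phi0. Qed.

Lemma nrm2_shifted_phi0 a : nrm2 (shifted_phi0 a) = 1.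
Proof.
have := inner_diag (shifted_phi0 a).
rewrite (inner_tfshift _ L2_phi0 L2_phi0) inner_phi0.
by move=> /(congr1 (@complex.Re R)).
Qed.

Lemma L2_nonzero_shifted_phi0 a : L2_nonzero (shifted_phi0 a).
Proof.
have La := L2_shifted_phi0 a; split=> // /(nrm2_eq0 La).
by rewrite nrm2_shifted_phi0 => /eqP; rewrite oner_eq0.
Qed.

Lemma amp_gt0 a y : 0 < amp a y.
Proof. by rewrite mulr_gt0 ?expR_gt0// powR_gt0. Qed.

Lemma sqc_shifted_phi0 a y : sqc (shifted_phi0 a y) = amp a y ^+ 2.
Proof. by rewrite /shifted_phi0 /tfshift sqc_cis /sqc /phi0/= expr0n/= addr0. Qed.

Definition midpoint a x : E := [tuple ((tnth a i : R) + tnth x i) / 2 | i < d].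

(** With m the midpoint of a and x, |y - a|^2 + |y - x|^2 = 2 |y - m|^2 + |x - a|^2 / 2, and the
    factor in y has integral 1. *)
Lemma amp_mul a x y : amp a y * amp x y =
  expR (- (pi / 2) * dot (tsub x a) (tsub x a)) *
  sqc (@phi0 R d (tsub y (midpoint a x))).
Proof.
rewrite sqc_phi0 /gauss /amp mulrACA -powRD; last by rewrite pnatr_eq0 implybT.
rewrite [RHS]mulrCA -!expRD; congr (_ `^ _ * expR _); first by field.
rewrite /dot !mulr_sumr -sumrN -!big_split/=; apply: eq_bigr => i _.
by rewrite !tnth_mktuple; field.
Qed.

Lemma amp_integral_le a x (m : E -> R) : measurable_fun setT m ->
  (forall y, `|m y| <= amp a y) ->
  `|\int[mu]_y (m y * amp x y)| <= expR (- (pi / 2) * dot (tsub x a) (tsub x a)).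
Proof.
move=> mm ma; set e := expR _.
have mphi := measurable_sqc (L2_cmeasurable (@L2_phi0 R d)).
have [_ iphi] := (L2P (@phi0 R d)).1 L2_phi0.
have iaa : integrableR mu (fun y => amp a y * amp x y).
  have := integrableRZ e (integrableR_tsub (midpoint a x) iphi).
  by apply: eq_integrable => // y _ /=; rewrite amp_mul.
have maa y : `|m y * amp x y| <= amp a y * amp x y.
  by rewrite normrM (gtr0_norm (amp_gt0 x y)) ler_wpM2r// ltW// amp_gt0.
have -> : e = \int[mu]_y (amp a y * amp x y).
  under eq_Rintegral do rewrite amp_mul.
  rewrite RintegralZl//; last exact: (integrableR_tsub (midpoint a x) iphi).
  by rewrite (Rintegral_tsub (midpoint a x) mphi) -/(nrm2 _) nrm2_phi0 mulr1.
apply: Rintegral_norm_le => //.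
apply: integrableR_le iaa _ => //.
  by apply: measurable_funM => //; exact: (measurable_fun_pair2 x measurable_amp).
by move=> y; rewrite (le_trans (maa y))// ler_norm.
Qed.

(** The factor 2 comes from bounding the real and imaginary parts separately. *)
Lemma sqc_stft_shifted_le a z :
  sqc (stft (shifted_phi0 a) z) <= 2 * expR (- pi * dot (tsub z.1 a) (tsub z.1 a)).
Proof.
have mf := L2_cmeasurable (L2_shifted_phi0 a).
have key (m : E -> R) : measurable_fun setT m ->
    (forall y, m y ^+ 2 <= sqc (shifted_phi0 a y)) ->
    (\int[mu]_y (m y * amp z.1 y)) ^+ 2 <= expR (- pi * dot (tsub z.1 a) (tsub z.1 a)).
  move=> mm h; have ma y : `|m y| <= amp a y.
    rewrite -(@ler_pXn2r _ 2)// ?nnegrE// ?(ltW (amp_gt0 _ _))//.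
    by rewrite real_normK ?num_real// -sqc_shifted_phi0.
  have := lerXn2r 2 (normr_ge0 _) (expR_ge0 _) (amp_integral_le z.1 mm ma).
  rewrite real_normK ?num_real// => /le_trans; apply; rewrite expr2 -expRD ler_expR le_eqVlt; apply/orP; left.
  by apply/eqP; field.
rewrite /sqc Re_stft Im_stft mulr_natl mulr2n lerD//; apply: key => y.
- exact: (measurable_fun_pair2 z.2 (measurable_modRe mf)).
- exact: modRe_sqr_le.
- exact: (measurable_fun_pair2 z.2 (measurable_modIm mf)).
- exact: modIm_sqr_le.
Qed.

Definition diag_pt n : E := [tuple n%:R | i < d].

(** One coordinate t of x suffices, and d > 0 provides it. From (t - n)^2 >= 2 (n - t) - 1 follows a
    geometric bound of ratio exp(-2 pi), with the constant [c]. *)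
Lemma cvg_stft_diag z : (0 < d)%N ->
  sqc (stft (shifted_phi0 (diag_pt n)) z) @[n --> \oo] --> (0 : R).
Proof.
move=> d0; pose i0 : 'I_d := Ordinal d0; pose t : R := tnth z.1 i0.
pose c := 2 * expR (pi * (2 * t + 1)).
have q1 : `|expR (- (2 * pi)) : R| < 1.
  by rewrite ger0_norm ?expR_ge0// expR_lt1 oppr_lt0 mulr_gt0// pi_gt0.
have h0 : c * expR (- (2 * pi)) ^+ n @[n --> \oo] --> (c * 0 : R).
  by apply: cvgM; [exact: cvg_cst|exact: cvg_expr].
rewrite mulr0 in h0.
apply: (squeeze_cvgr _ (cvg_cst 0) h0); near=> n; rewrite sqc_ge0/=.
apply: le_trans (sqc_stft_shifted_le _ _) _.
rewrite /c -mulrA ler_wpM2l// -expRM_natl -expRD ler_expR.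
have hd : (t - n%:R) ^+ 2 <= dot (tsub z.1 (diag_pt n)) (tsub z.1 (diag_pt n)).
  rewrite /dot (bigD1 i0)//= !tnth_mktuple -expr2 lerDl.
  by apply: sumr_ge0 => i _; rewrite -expr2 sqr_ge0.
have : 2 * (n%:R - t) - 1 <= (t - n%:R) ^+ 2.
  by rewrite -subr_ge0; have := sqr_ge0 (n%:R - t - 1); nra.
move=> /le_trans /(_ hd) /(ler_wpM2l (ltW (pi_gt0 R))) h.
rewrite mulNr lerNl; apply: le_trans h; rewrite le_eqVlt; apply/orP; left.
by apply/eqP; ring.
Unshelve. all: by end_near. Qed.

End gaussian_sequence.

(** * The value of the supremum *)

Section supremum.
Context {R : realType} {d : nat} (p : R) (Omega : set (phase_space R d)).
Local Notation vol := (vol R d).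
Hypotheses (d0 : (0 < d)%N) (p1 : 1 <= p) (mO : measurable Omega).
Hypotheses (O0 : (0 < vol Omega)%E) (Oy : (vol Omega < +oo)%E).

Let fn n : Rd R d -> R[i] := shifted_phi0 (diag_pt n).

Let p0 : 0 < p. Proof. exact: lt_le_trans p1. Qed.

Lemma cvg_Qpow_diag z : Qpow p (fn n) z @[n --> \oo] --> (1 : R).
Proof.
pose k : R := (Num.truncn p).+1%:R.
have h0 : 1 - k * sqc (stft (fn n) z) @[n --> \oo] --> (1 - k * 0 : R).
  apply: cvgB; first exact: cvg_cst.
  by apply: cvgM; [exact: cvg_cst|exact: cvg_stft_diag].
rewrite mulr0 subr0 in h0.
have h1 : cst (1 : R) n @[n --> \oo] --> (1 : R) by exact: cvg_cst.
apply: (squeeze_cvgr _ h0 h1); near=> n.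
have Lf : L2 (fn n) by exact: L2_shifted_phi0.
have := (Qfun_S0E z Lf).2; rewrite /Qpow nrm2_shifted_phi0 => s1.
have s01 : 0 <= sqc (stft (fn n) z) <= 1 by rewrite sqc_ge0.
by rewrite powR_onem_ge//= powR_onem_le1// ltW.
Unshelve. all: by end_near. Qed.

Lemma cvg_integral_Qpow_diag :
  (\int[vol]_(z in Omega) (Qpow p (fn n) z)%:E @[n --> \oo] --> vol Omega)%E.
Proof.
have [] := @dominated_convergence _ _ _ vol Omega mO
  (fun n => EFin \o Qpow p (fn n)) (cst 1%E) (cst 1%E).
- move=> n; apply/measurable_EFinP; apply: measurable_funS (measurable_Qpow p _) => //.
  exact: L2_shifted_phi0.
- exact: measurable_cst.
- apply: aeW => z _; apply: cvg_EFin; first exact: nearW.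
  exact: cvg_Qpow_diag.
- exact: integrable_cst_lty.
- apply: aeW => z n _ /=.
  have := Qpow_itv p1 z (L2_shifted_phi0 (diag_pt n)).
  rewrite nrm2_shifted_phi0 powR1 => /andP[q0 q1].
  by rewrite lee_fin ger0_norm.
by move=> _ _; rewrite integral_cst// mul1e.
Qed.

(** For the lower bound, a finite supremum r bounds every integral by r^p; the limit of the
    integrals gives |Omega| <= r^p, and the root is taken only then. *)
Lemma ereal_sup_Qratio :
  ereal_sup [set Qratio p Omega f | f in @L2_nonzero R d] = (vol Omega `^ p^-1)%E.
Proof.
apply/eqP; rewrite eq_le; apply/andP; split.
  by apply: ge_ereal_sup => _ [f Lf <-]; apply: ltW; exact: Qratio_lt.
set s := ereal_sup _.
have Qs n : (Qratio p Omega (fn n) <= s)%E.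
  by apply: ereal_sup_ubound; exists (fn n) => //; exact: L2_nonzero_shifted_phi0.
have QE n : Qratio p Omega (fn n) = ((\int[vol]_(z in Omega) Qpow p (fn n) z) `^ p^-1)%:E.
  have [_ ->] := QratioE p1 mO Oy (L2_nonzero_shifted_phi0 (diag_pt n)).
  by rewrite nrm2_shifted_phi0 invr1 mulr1.
have vE : vol Omega = (fine (vol Omega))%:E by rewrite fineK// ge0_fin_numE.
case: s Qs => [r| |] Qs; [|by rewrite leey|by have := Qs 0; rewrite QE].
have A0 n : 0 <= \int[vol]_(z in Omega) Qpow p (fn n) z.
  by apply: Rintegral_ge0 => z _; exact: powR_ge0.
have r0 : 0 <= r by have := Qs 0; rewrite QE lee_fin; apply: le_trans; exact: powR_ge0.
have An n : (\int[vol]_(z in Omega) (Qpow p (fn n) z)%:E <= (r `^ p)%:E)%E.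
  rewrite -[leLHS]fineK; last first.
    exact/integrable_fin_num/integrable_Qpow/L2_shifted_phi0.
  rewrite lee_fin; have := Qs n; rewrite QE lee_fin; have := A0 n.
  rewrite -/(Rintegral vol Omega (Qpow p (fn n))).
  move: (\int[vol]_(z in Omega) _) => A A0' Ar.
  have -> : A = (A `^ p^-1) `^ p by rewrite -powRrM mulVf ?gt_eqF// powRr1.
  by apply: ge0_ler_powR; rewrite ?nnegrE ?powR_ge0// ltW.
have : (vol Omega <= (r `^ p)%:E)%E.
  rewrite -(cvg_lim _ cvg_integral_Qpow_diag)//; apply: lime_le.
    by apply/cvg_ex; eexists; exact: cvg_integral_Qpow_diag.
  exact: nearW.
rewrite vE poweR_EFin !lee_fin => h.
have -> : r = (r `^ p) `^ p^-1 by rewrite -powRrM mulfV ?gt_eqF// powRr1.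
by apply: ge0_ler_powR; rewrite ?nnegrE ?powR_ge0 ?fine_ge0// invr_ge0 ltW.
Qed.

End supremum.

Unset Implicit Arguments.
Local Close Scope complex_scope.
Local Close Scope ring_scope.
Local Open Scope classical_set_scope.
Local Open Scope ereal_scope.

Theorem proposition4p1 (R : realType) (d : nat) (p : R)
    (Omega : set (phase_space R d)) :
  (0 < d)%N -> (1 <= p)%R ->
  measurable Omega -> 0 < vol R d Omega -> vol R d Omega < +oo ->
  ereal_sup [set Qratio p Omega f | f in @L2_nonzero R d] =
    vol R d Omega `^ p^-1 /\
  ~ (exists2 f, L2_nonzero f &
       Qratio p Omega f = ereal_sup [set Qratio p Omega g | g in @L2_nonzero R d]).
Proof.
move=> d0 p1 mO O0 Oy; have sup := ereal_sup_Qratio d0 p1 mO O0 Oy.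
split=> // -[f Lf]; rewrite sup => Qf.
by have := Qratio_lt p1 mO O0 Oy Lf; rewrite Qf ltxx.
Qed.
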